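(* Let $\varphi$ be an Orlicz $N$-function satisfying Condition $Q$. Let $N\ge 1$ be an integer, $a_1,\dots,a_N\in\mathbb{R}$, and let $\kappa$ be one of the functions $\kappa(v)=\cos v$ or $\kappa(v)=\sin v$. Put $$I(t,x,\lambda)=\kappa\Big(\lambda x+t\sum_{k=1}^{N}a_k\lambda^{2k+1}(-1)^k\Big).$$ Let $y=\{y(u),u\in\mathbb{R}\}$ be a real strictly $\varphi$-sub-Gaussian random process with determining constant $C_y$ and covariance function $\Gamma_y(s,t)=\mathsf{E}\,y(t)y(s)$ of finite variation, and let $$U(t,x)=\int_{-\infty}^{\infty}I(t,x,\lambda)\,dy(\lambda),\qquad a\le t\le b,\ c\le x\le d.$$ Assume that $U(t,x)$ exists and is continuous with probability one. Let $Z=\{Z(u),u\ge 0\}$ be an admissible function for the space $\mathrm{Sub}_\varphi(\Omega)$, with associated constant $u_0\ge 0$, and assume that the integral $$C_Z^2=\int_{-\infty}^{\infty}\int_{-\infty}^{\infty}\Big(Z\big(\tfrac{|\lambda|}{2}+u_0\big)+Z\big(\tfrac12\big|\sum_{k=1}^{N}a_k\lambda^{2k+1}(-1)^k\big|+u_0\big)\Big)\Big(Z\big(\tfrac{|\mu|}{2}+u_0\big)+Z\big(\tfrac12\big|\sum_{k=1}^{N}a_k\mu^{2k+1}(-1)^k\big|+u_0\big)\Big)\,d|\Gamma_y(\lambda,\mu)|$$ converges. Put $\varkappa=\max(b-a,d-c)$, $$\sigma(h)=2C_yC_Z\Big(Z\big(\tfrac1h+u_0\big)\Big)^{-1}\quad(0<h<\varkappa),\qquad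 \gamma_0=\frac{2C_yC_Z}{Z(\frac1\varkappa+u_0)},\qquad \varepsilon_0=\sup_{a\le t\le b,\ c\le x\le d}\tau_\varphi(U(t,x)).$$ Let $r(x)$, $x\ge 1$, be a non-negative, monotone increasing function such that the function $r(e^x)$, $x\ge 0$, is convex, and assume that for $0<\varepsilon\le\gamma_0$ $$\int_0^{\varepsilon}r\left(\Big(\frac{b-a}{2\sigma^{(-1)}(v)}+1\Big)\Big(\frac{d-c}{2\sigma^{(-1)}(v)}+1\Big)\right)dv<\infty .$$ Then for all $0<\theta<1$ and $u>0$ $$P\Big\{\sup_{a\le t\le b,\ c\le x\le d}|U(t,x)|>u\Big\}\le 2\hat A(\theta,u),$$ where $$\hat A(\theta,u)=\exp\Big\{-\varphi^*\Big(\frac{u(1-\theta)}{\varepsilon_0}\Big)\Big\}\,r^{(-1)}\left(\frac{\hat I_r(\min(\theta\varepsilon_0,\gamma_0))}{\theta\varepsilon_0}\right),$$ $$\hat I_r(\delta)=\int_0^{\delta}r\left(\Big[\frac{b-a}{2}\Big(Z^{(-1)}\big(\tfrac{2C_ZC_y}{s}\big)-u_0\Big)+1\Big]\Big[\frac{d-c}{2}\Big(Z^{(-1)}\big(\tfrac{2C_ZC_y}{s}\big)-u_0\Big)+1\Big]\right)ds .$$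
   Context: All random variables are real and live on a standard probability space $\{\Omega,L,\mathbf P\}$. The superscript $(-1)$ denotes the inverse function. A continuous even convex function $\varphi:\mathbb{R}\to\mathbb{R}$ is an Orlicz $N$-function if $\varphi(0)=0$, $\varphi(x)>0$ for $x\ne0$, $\lim_{x\to0}\varphi(x)/x=0$ and $\lim_{x\to\infty}\varphi(x)/x=\infty$. Condition $Q$: $\liminf_{x\to0}\varphi(x)/x^2=c>0$ ($c=\infty$ allowed). $\varphi^*(x)=\sup_{y\in\mathbb{R}}(xy-\varphi(y))$ is the Young–Fenchel transform of $\varphi$. A random variable $\zeta$ is $\varphi$-sub-Gaussian ($\zeta\in\mathrm{Sub}_\varphi(\Omega)$) if $\mathsf E\zeta=0$, $\mathsf E\exp\{\lambda\zeta\}$ exists for all $\lambda\in\mathbb{R}$, and there is $a>0$ with $\mathsf E\exp\{\lambda\zeta\}\le\exp\{\varphi(\lambda a)\}$ for all $\lambda\in\mathbb{R}$. Its norm is $\tau_\varphi(\zeta)=\inf\{a>0:\mathsf E\exp\{\lambda\zeta\}\le\exp\{\varphi(a\lambda)\}\ \text{for all }\lambda\in\mathbb{R}\}$. A family $\Delta\subset\mathrm{Sub}_\varphi(\Omega)$ is strictly $\varphi$-sub-Gaussian with determining constant $C_\Delta$ if for every countable set $\{\zeta_i\}_{i\in I}\subset\Delta$ and all $\lambda_i\in\mathbb{R}$, $\tau_\varphi(\sum_{i\in I}\lambda_i\zeta_i)\le C_\Delta\big(\mathsf E(\sum_{i\in I}\lambda_i\zeta_i)^2\big)^{1/2}$.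 A random process is strictly $\varphi$-sub-Gaussian if the family of its values is; $C_y$ denotes the determining constant of the process $y$. Integrals $\int\cdot\,dy(\lambda)$ are understood in the mean-square sense. $d|\Gamma_y(\lambda,\mu)|$ denotes integration with respect to the total variation of (the Lebesgue–Stieltjes bimeasure generated by) $\Gamma_y$. Admissible function: $Z(u)$, $u\ge0$, is admissible for $\mathrm{Sub}_\varphi(\Omega)$ if $Z$ is continuous and increasing, $Z(u)>0$ for $u>0$, there is a constant $u_0\ge0$ such that $u/Z(u)$ is non-decreasing for $u>u_0$, and for some $\varepsilon>0$ the integral $\int_0^\varepsilon\Psi\big(\ln\big(Z^{(-1)}(1/s)-u_0\big)\big)ds$ converges, where $\Psi(v)=v/\varphi^{(-1)}(v)$, $v>0$. (The field $U$ represents the solution of $\sum_{k=1}^N a_k\,\partial^{2k+1}U/\partial x^{2k+1}=\partial U/\partial t$, $U(0,x)=\eta(x)$, with $\eta(x)=\int_{\mathbb{R}}\kappa(xu)\,dy(u)$.)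
   Formalization: The formal theorem additionally assumes r(1)=0 whenever γ_0<θε_0; without this the stated bound can fail, since Î_r(min(θε_0,γ_0)) omits the contribution r(1)(θε_0−γ_0) and adding a constant to r lowers the bound arbitrarily. *)

(* Defs.v *)
From HB Require Import structures.
From mathcomp Require Import all_boot all_order all_algebra.
From mathcomp Require Import all_classical all_reals all_analysis.
Set Implicit Arguments.
Unset Strict Implicit.
Unset Printing Implicit Defensive.
Import Order.TTheory GRing.Theory Num.Theory.
Import numFieldNormedType.Exports.
Local Open Scope classical_set_scope.
Local Open Scope ring_scope.

(* Inverse f^(-1) of a function f whose domain is A. It is meant to be used at
   points of f @` A with f injective on A; elsewhere it is 0 by convention. *)
Definition inv_on (R : realType) (A : set R) (f : R -> R) : R -> R :=
  'pinv_(fun=> 0) A f.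

Section Orlicz.
Context {R : realType}.
Implicit Type phi : R -> R.

Definition Orlicz_Nfunction phi : Prop :=
  [/\ continuous phi,
      forall x, phi (- x) = phi x &
      convex_function (E := R^o) setT phi] /\
  [/\ phi 0 = 0,
      forall x, x != 0 -> 0 < phi x,
      phi x / x @[x --> 0^'] --> (0 : R) &
      phi x / x @[x --> +oo] --> +oo].

Definition condition_Q phi : Prop :=
  (0 < lime_inf (fun x => (phi x / x ^+ 2)%:E) 0)%E.

(* The set is bounded above because an N-function is superlinear, so that
   the real supremum is the right one. *)
Definition Young_Fenchel phi (x : R) : R :=
  sup [set x * y - phi y | y in [set: R]].

(* An N-function is a bijection of [0, +oo[ onto itself. *)
Definition Psi phi (v : R) : R := v / inv_on `[0, +oo[ phi v.

(* The unboundedness of Z is implicit in the use of Z^(-1)(1/s) for all small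
   s > 0. The integrand takes harmless bounded values where its argument
   ln (Z^(-1)(1/s) - u0) is not positive, and only small s matter. *)
Definition admissible phi (Z : R -> R) (u0 : R) : Prop :=
  [/\ {within `[0, +oo[, continuous Z},
      {in `[0, +oo[ &, {homo Z : u v / u < v}},
      forall u, 0 < u -> 0 < Z u &
      Z u @[u --> +oo] --> +oo] /\
  [/\ 0 <= u0,
      {in `]u0, +oo[ &, {homo (fun u => u / Z u) : u v / u <= v}} &
      exists2 e : R, 0 < e &
        (@lebesgue_measure R).-integrable `]0, e[
          (fun s => (Psi phi (ln (inv_on `[0, +oo[ Z (1 / s) - u0)))%:E)].

End Orlicz.

Section SubGaussian.
Context {d : measure_display} {Omega : measurableType d} {R : realType}.
Variable P : probability Omega R.
Implicit Types (phi : R -> R) (X : {RV P >-> R}) (y : R -> {RV P >-> R}).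

Definition sub_gaussian phi X : Prop :=
  [/\ ('E_P[X] = 0)%E,
      forall l, ('M_P X l < +oo)%E &
      exists2 a, 0 < a & forall l, ('M_P X l <= (expR (phi (l * a)))%:E)%E].

Definition tau phi X : \bar R :=
  ereal_inf [set a%:E | a in
    [set a | 0 < a /\ forall l, ('M_P X l <= (expR (phi (a * l)))%:E)%E]].

Definition ms_dist2 (X Y : Omega -> R) : \bar R :=
  'E_P[fun w => (X w - Y w) ^+ 2].

(* A countable linear combination is the mean-square sum S of a series; finite
   combinations are those whose coefficients eventually vanish. *)
Definition strictly_sub_gaussian phi (Delta : set {RV P >-> R}) (C : R)
    : Prop :=
  (forall X, Delta X -> sub_gaussian phi X) /\
  forall (zeta : nat -> {RV P >-> R}) (l : nat -> R) (S : {RV P >-> R}),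
    (forall i, Delta (zeta i)) ->
    ms_dist2 (fun w => \sum_(i < n) l i * zeta i w) S @[n --> \oo] --> 0%E ->
    (tau phi S <= (C * Num.sqrt (fine 'E_P[fun w => S w ^+ 2]))%:E)%E.

Definition strictly_sub_gaussian_process phi y (C : R) : Prop :=
  strictly_sub_gaussian phi (range y) C.

Definition covariance_fun y (s t : R) : R :=
  fine 'E_P[fun w => y t w * y s w].

(* Mean-square Riemann-Stieltjes integral of f with respect to y. *)

Definition RS_sum (f : R -> R) y (n : nat) (x xi : nat -> R) (w : Omega) : R :=
  \sum_(i < n) f (xi i) * (y (x i.+1) w - y (x i) w).

Definition is_ms_integral_on (f : R -> R) y (al be : R) (J : {RV P >-> R})
    : Prop :=
  forall e : R, 0 < e -> exists2 delta : R, 0 < delta &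
    forall (n : nat) (x xi : nat -> R),
      x 0%N = al -> x n = be ->
      (forall i, (i < n)%N -> x i <= xi i <= x i.+1) ->
      (forall i, (i < n)%N -> x i.+1 - x i < delta) ->
      (ms_dist2 (RS_sum f y n x xi) J < e%:E)%E.

Definition is_ms_integral (f : R -> R) y (X : {RV P >-> R}) : Prop :=
  exists J : R -> R -> {RV P >-> R},
    (forall al be, al < be -> is_ms_integral_on f y al be (J al be)) /\
    forall e : R, 0 < e -> exists A : R, forall al be : R,
      al < - A -> A < be -> (ms_dist2 (J al be) X < e%:E)%E.

End SubGaussian.

Section Bimeasure.
Context {R : realType}.
Implicit Type G : R -> R -> R.

Definition rect_increment G (s s' t t' : R) : R :=
  G s' t' - G s' t - G s t' + G s t.

(* Vitali variation over the whole plane *)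
Definition finite_variation G : Prop :=
  exists M : R, forall (m n : nat) (s t : nat -> R),
    {homo s : i j / (i <= j)%N >-> i <= j} ->
    {homo t : i j / (i <= j)%N >-> i <= j} ->
    \sum_(i < m) \sum_(j < n)
      `|rect_increment G (s i) (s i.+1) (t j) (t j.+1)| <= M.

Definition planeR := (measurableTypeR R * measurableTypeR R)%type.

(* nu is the Lebesgue-Stieltjes bimeasure generated by G. The limits from the
   right allow for G not being right-continuous; they exist as soon as G has
   finite variation, and then nu exists and is unique. *)
Definition LS_bimeasure G (nu : {charge set planeR -> \bar R}) : Prop :=
  forall s s' t t' : R, s <= s' -> t <= t' ->
    rect_increment G (s + h) (s' + h) (t + h) (t' + h) @[h --> 0^'+] -->
    fine (nu (`]s, s'] `*` `]t, t'])).

End Bimeasure.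

Section Theorem_data.
Context {R : realType}.
Implicit Types (alpha Z r : R -> R).

Definition symbol (N : nat) (ak : nat -> R) (l : R) : R :=
  \sum_(1 <= k < N.+1) ak k * l ^+ (2 * k + 1) * (-1) ^+ k.

Definition kernelI (kappa : R -> R) N ak (t x l : R) : R :=
  kappa (l * x + t * symbol N ak l).

Definition weight N ak Z (u0 l : R) : R :=
  Z (`|l| / 2 + u0) + Z (`|symbol N ak l| / 2 + u0).

Section Variation.
Context {nu : {charge set @planeR R -> \bar R}} {Pos Neg : set (@planeR R)}.
Variable nuPN : hahn_decomposition nu Pos Neg.

(* the integral C_Z^2 with respect to d|Gamma| *)
Definition CZ2 N ak Z u0 : \bar R :=
  (\int[charge_variation nuPN]_p
     (weight N ak Z u0 p.1 * weight N ak Z u0 p.2)%:E)%E.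

Definition CZ N ak Z u0 : R := Num.sqrt (fine (CZ2 N ak Z u0)).

End Variation.

Definition sigma (Cy Cz : R) Z (u0 h : R) : R := 2 * Cy * Cz / Z (1 / h + u0).

Definition sigma_inv (Cy Cz : R) Z (u0 vk : R) : R -> R :=
  inv_on `]0, vk[ (sigma Cy Cz Z u0).

Definition gamma0 (Cy Cz : R) Z (u0 vk : R) : R :=
  2 * Cy * Cz / Z (1 / vk + u0).

Definition entropy_integral (Cy Cz : R) Z (u0 a b c d : R) r (e : R) : \bar R :=
  let vk := Num.max (b - a) (d - c) in
  (\int[lebesgue_measure]_(v in `]0%R, e[)
     (r (((b - a) / (2 * sigma_inv Cy Cz Z u0 vk v) + 1) *
         ((d - c) / (2 * sigma_inv Cy Cz Z u0 vk v) + 1)))%:E)%E.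

Definition I_hat (Cy Cz : R) Z (u0 a b c d : R) r (delta : R) : R :=
  fine (\int[lebesgue_measure]_(s in `]0%R, delta[)
     (r (((b - a) / 2 * (inv_on `[0%R, +oo[ Z (2 * Cz * Cy / s) - u0) + 1) *
         ((d - c) / 2 * (inv_on `[0%R, +oo[ Z (2 * Cz * Cy / s) - u0) + 1)))%:E)%E.

Definition A_hat phi (Cy Cz : R) Z (u0 a b c d : R) r (eps0 theta u : R) : R :=
  let g0 := gamma0 Cy Cz Z u0 (Num.max (b - a) (d - c)) in
  expR (- Young_Fenchel phi (u * (1 - theta) / eps0)) *
  inv_on `[1, +oo[ r
    (I_hat Cy Cz Z u0 a b c d r (Num.min (theta * eps0) g0) / (theta * eps0)).

End Theorem_data.

(* Main.v *)
Require Import Defs.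
From HB Require Import structures.
From mathcomp Require Import all_boot all_order all_algebra.
From mathcomp Require Import all_classical all_reals all_analysis.
From mathcomp Require Import ring lra measurable_realfun.
Set Implicit Arguments.
Unset Strict Implicit.
Unset Printing Implicit Defensive.
Import Order.TTheory GRing.Theory Num.Theory.
Import numFieldNormedType.Exports.
Local Open Scope classical_set_scope.
Local Open Scope ring_scope.

(* A finite linear combination S of values of y satisfies
   E exp(l S) <= exp(phi(l Cy sqrt(E S^2))); Fatou's lemma carries this bound over
   to mean-square integrals against y. The second moment of the integral of f is
   at most the integral of |f(l) f(m)| against d|Gamma|, so, by
   |cos A - cos B| <= min(2, |A - B|) and the monotonicity of u / Z(u), the
   increment of U between points at distance h in the maximum norm has norm at
   most sigma(h).

   Chaining runs along nets V_k of mesh sigma^(-1)(theta^k eps0), the k-th link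
   getting the weight p_k = (1 - theta) theta^(k-1). This makes every link
   contribute the same exponent phi(lambda eps0 / (1 - theta)) and bounds the
   exponential moment of max_{V_n} |U| by twice its exponential times
   prod_k |V_k|^(p_k). As x |-> r(e^x) is convex, r maps the product to at most
   sum_k p_k r(|V_k|), a lower sum of the entropy integral divided by theta eps0.
   Markov's inequality, optimised over lambda, and continuity of the paths, which
   lets the nets exhaust the rectangle, give the tail bound. When eps0 = 0 or
   C_Z = 0 the field vanishes or is constant almost surely. *)

(** The bimeasure [nu] is tied to the covariance only through limits from the right, so the second
    moment of a Riemann-Stieltjes sum cannot be compared with [nu] on a fixed partition. All
    approximations are therefore kept uniform under a shift of the partition by [h] in [0, 1], and
    [h] tends to 0 in a fixed finite sum.

    The weights (1 - theta) theta^k of the first n links add up to 1 - theta^n. Jensen's inequality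
    puts the missing mass at 0, where r(e^0) = r 1, and the lower sum pays for it on the end ]0,
    theta^n T[ of the entropy integral, T = theta eps0. When T exceeds [gamma0], the lower sum also
    covers [gamma0, T[, outside the range of [I_hat]; there the covering number is 1, and r 1 = 0
    makes this stretch free.

    The nets are not nested, so the supremum is compared with the lower limit of the net events. As
    a supremum over an uncountable set it need not be measurable, whence the outer measure. *)

Section RealAnalysis.
Context {R : realType}.

(** * Orlicz N-functions and weighted geometric means *)

Lemma convex_functionP (D : set R) (f : R -> R) :
  convex_function (E := R^o) D f -> forall t x y, 0 <= t -> t <= 1 ->
  D x -> D y -> f (t * x + (1 - t) * y) <= t * f x + (1 - t) * f y.
Proof.
move=> cf t x y t0 t1 Dx Dy.
by have := cf (Itv01 t0 t1) x y (mem_set Dx) (mem_set Dy); rewrite !convRE.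
Qed.

(** By evenness only absolute values matter, and |x| is a convex combination of |y| and 0, where
    [phi] vanishes. *)
Lemma Nfunction_le (phi : R -> R) x y : Orlicz_Nfunction phi ->
  `|x| <= `|y| -> phi x <= phi y.
Proof.
move=> [[_ ev cvx] [phi0 pos _ _]] xy.
have abs z : phi `|z| = phi z by case: (ger0P z).
rewrite -(abs x) -(abs y).
have [y0|y0] := eqVneq `|y| 0.
  by move: xy; rewrite y0 normr_le0 => /eqP ->; rewrite normr0.
have y_gt0 : 0 < `|y| by rewrite lt_neqAle eq_sym y0 normr_ge0.
have phiy0 : 0 <= phi `|y| by exact/ltW/pos.
have t0 : 0 <= `|x| / `|y| by exact: divr_ge0.
have t1 : `|x| / `|y| <= 1 by rewrite ler_pdivrMr// mul1r.
have := convex_functionP cvx t0 t1 (I : setT `|y|) (I : setT 0).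
rewrite divfK// mulr0 addr0 phi0 mulr0 addr0 => /le_trans; apply.
by rewrite ler_piMl.
Qed.

Lemma Nfunction_ge0 (phi : R -> R) x : Orlicz_Nfunction phi -> 0 <= phi x.
Proof.
move=> phiN; have [_ [phi0 _ _ _]] := phiN.
by rewrite -phi0; apply: Nfunction_le => //; rewrite normr0.
Qed.

Lemma Young_Fenchel_ge (phi : R -> R) (x B : R) : Orlicz_Nfunction phi ->
  0 <= x -> (forall l, 0 <= l -> x * l - phi l <= B) ->
  Young_Fenchel phi x <= B.
Proof.
move=> phiN x0 h; have [[_ ev _] _] := phiN.
apply: ge_sup; first by exists (x * 0 - phi 0); exists 0.
move=> _ [l _ <-]; have [l0|l0] := leP 0 l; first exact: h.
apply: (@le_trans _ _ (x * (- l) - phi (- l))); last by apply: h; lra.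
by rewrite ev; nra.
Qed.

(* The partial sum of the geometric series of ratio [th], normalised so that
   the remaining mass [th ^+ n] may be put at [0]. *)
Definition geo_mean (th : R) (n : nat) (x : nat -> R) : R :=
  \sum_(k < n) (1 - th) * th ^+ k * x k.

Lemma geo_mean0 th x : geo_mean th 0 x = 0.
Proof. by rewrite /geo_mean big_ord0. Qed.

Lemma geo_meanS th n x :
  geo_mean th n.+1 x = (1 - th) * x 0%N + th * geo_mean th n (x \o succn).
Proof.
rewrite /geo_mean big_ord_recl/= expr0 mulr1; congr (_ + _).
by rewrite mulr_sumr; apply: eq_bigr => i _; rewrite /bump/= add1n exprS; ring.
Qed.

Lemma geo_mean_ge0 th n x : 0 <= th -> th <= 1 -> (forall k, 0 <= x k) ->
  0 <= geo_mean th n x.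
Proof.
move=> th0 th1 x0; apply: sumr_ge0 => i _.
by rewrite mulr_ge0// mulr_ge0 ?exprn_ge0// subr_ge0.
Qed.

(** Jensen's inequality by repeated two-point convexity: [geo_meanS] writes the mean as a
    combination of the first term, with weight 1 - th, and the mean of the shifted sequence. *)
Lemma geo_mean_convex (f : R -> R) th n x :
  convex_function (E := R^o) `[0, +oo[ f -> (forall k, 0 <= x k) ->
  0 <= th -> th <= 1 ->
  f (geo_mean th n x) <= geo_mean th n (f \o x) + th ^+ n * f 0.
Proof.
move=> cf x0 th0 th1; elim: n x x0 => [|n IH] x x0.
  by rewrite !geo_mean0 expr0 mul1r add0r.
rewrite !geo_meanS; set m := geo_mean _ _ _.
have m0 : 0 <= m by apply: geo_mean_ge0 => // k; exact: x0.
have := @convex_functionP _ _ cf (1 - th) (x 0%N) m.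
rewrite !set_itvE/= subr_ge0 lerBlDr lerDl.
have -> : 1 - (1 - th) = th by ring.
move=> /(_ th1 th0 (x0 _) m0) /le_trans; apply.
have := IH (x \o succn) (fun k => x0 _); rewrite -/m => /(ler_wpM2l th0).
rewrite exprS/=; move: (geo_mean _ _ _) => w; lra.
Qed.

Lemma convex_expR01 (t x y : R) : 0 <= t -> t <= 1 ->
  expR (t * x + (1 - t) * y) <= t * expR x + (1 - t) * expR y.
Proof.
move=> t0 t1; have := convex_expR (Itv01 t0 t1) x y.
by rewrite !convRE.
Qed.

(** The terms may be negative here, so this is not an instance of [geo_mean_convex], whose convexity
    holds on [0, +oo[ only. *)
Lemma geo_mean_expR th n x : 0 <= th -> th <= 1 ->
  expR (geo_mean th n x) <= geo_mean th n (expR \o x) + th ^+ n.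
Proof.
move=> th0 th1; elim: n x => [|n IH] x.
  by rewrite !geo_mean0 expr0 expR0 add0r.
rewrite !geo_meanS; set m := geo_mean _ _ _.
have := @convex_expR01 (1 - th) (x 0%N) m.
rewrite subr_ge0 lerBlDr lerDl.
have -> : 1 - (1 - th) = th by ring.
move=> /(_ th1 th0) /le_trans; apply.
have := IH (x \o succn); rewrite -/m => /(ler_wpM2l th0).
rewrite exprS/=; move: (geo_mean _ _ _) => w; lra.
Qed.

Lemma geo_meanD th n x y :
  geo_mean th n (fun k => x k + y k) = geo_mean th n x + geo_mean th n y.
Proof.
by rewrite /geo_mean -big_split; apply: eq_bigr => i _ /=; ring.
Qed.

Lemma geo_mean_cst th n c : geo_mean th n (fun=> c) = (1 - th ^+ n) * c.
Proof.
elim: n => [|n IH]; first by rewrite geo_mean0 expr0 subrr mul0r.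
by rewrite geo_meanS/= IH exprS; ring.
Qed.

(** * The inverse of [r], from the convexity of r(e^x) *)

Section inverse_entropy.
Variable r : R -> R.
Hypothesis r_incr : {in `[1, +oo[ &, {homo r : x x' / x < x'}}.
Hypothesis r_cvx : convex_function (E := R^o) `[0, +oo[ (fun x => r (expR x)).

Let g (x : R) := r (expR x).

Let g_lt x y : 0 <= x -> x < y -> g x < g y.
Proof.
move=> x0 xy; apply: r_incr; rewrite ?in_itv/= ?andbT ?ltr_expR//.
  by rewrite -expR0 ler_expR.
by rewrite -expR0 ler_expR; lra.
Qed.

Let g_le x y : 0 <= x -> x <= y -> g x <= g y.
Proof. by move=> x0; rewrite le_eqVlt => /predU1P[->//|/g_lt/ltW]; apply. Qed.

Let g_cvx t x y : 0 <= t -> t <= 1 -> 0 <= x -> 0 <= y ->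
  g (t * x + (1 - t) * y) <= t * g x + (1 - t) * g y.
Proof.
move=> t0 t1 x0 y0; apply: (convex_functionP r_cvx) => //.
  by rewrite set_itvE.
by rewrite set_itvE.
Qed.

(** Continuity of [r] is not assumed: convexity and strict growth of [g] make it unbounded and leave
    no room for a jump at the supremum z of {g <= v}. *)
Lemma exp_convex_surj v : r 1 <= v -> exists2 z, 1 <= z & r z = v.
Proof.
move=> v1; have g0 : g 0 <= v by rewrite /g expR0.
pose S := [set x | 0 <= x /\ g x <= v].
have S0 : S 0 by [].
have dg : 0 < g 1 - g 0 by rewrite subr_gt0 g_lt.
have Sub : ubound S (Num.max 1 ((v - g 0) / (g 1 - g 0))).
  (* For x > 1 the point 1 lies on the chord from 0 to x, so g grows at least linearly with slope g
     1 - g 0. *)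
  move=> x [x0 gx]; rewrite le_max; have [//|x1 /=] := leP x 1.
  rewrite ler_pdivlMr//.
  have x_gt0 : 0 < x by lra.
  have := @g_cvx x^-1 x 0; rewrite invr_ge0 mulVf ?gt_eqF// mulr0 addr0.
  rewrite invf_le1// x0 ltW// lexx => /(_ erefl erefl erefl erefl).
  move/(ler_wpM2l x0); rewrite mulrDr !mulrA mulfV ?gt_eqF// mul1r.
  rewrite mulrBr mulfV ?gt_eqF//; lra.
have supS : has_sup S by split; [exists 0|exists (Num.max 1 ((v - g 0) / (g 1 -
  g 0)))].
set z := sup S.
have z0 : 0 <= z by exact: ub_le_sup supS.2 _ S0.
exists (expR z); first by rewrite -expR0 ler_expR.
rewrite -/(g z); apply/eqP; rewrite eq_le; apply/andP; split; rewrite leNgt;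
  apply/negP => gz.
- have z_gt0 : 0 < z by rewrite lt_neqAle z0 andbT; apply: contraTneq gz => <-;
  rewrite -leNgt.
  have gz1 : v < g (z + 1) by apply: (lt_trans gz); apply: g_lt => //; lra.
  (* If g z > v, then z lies on the chord from z - t, where g <= v, to z + 1. The first bound keeps
     z - t non-negative; the second makes the chord too low at z, the half giving strictness. *)
  pose t := Num.min (z / 2) ((g z - v) / (g (z + 1) - v) / 2).
  have t0 : 0 < t by rewrite lt_min !divr_gt0// subr_gt0.
  have tz : t <= z / 2 by rewrite ge_min lexx.
  have tg : t * (g (z + 1) - v) <= (g z - v) / 2.
    have : t <= (g z - v) / (g (z + 1) - v) / 2 by rewrite /t ge_min lexx orbT.
    rewrite mulrAC ler_pdivlMr ?subr_gt0//.
  have gzt : g (z - t) <= v.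
    have [x [x0 gx] zx] := @sup_adherent _ S t t0 supS.
    by apply: le_trans gx; apply: g_le; [lra|exact: ltW].
  have := @g_cvx (1 + t)^-1 (z - t) (z + 1).
  have t1 : 0 < 1 + t by lra.
  have t1' : 1 + t != 0 by rewrite gt_eqF.
  rewrite invr_ge0 (ltW t1) invf_le1// lerDl (ltW t0).
  move=> /(_ erefl erefl); have -> : 0 <= z - t by lra.
  have -> : 0 <= z + 1 by lra.
  have -> : (1 + t)^-1 * (z - t) + (1 - (1 + t)^-1) * (z + 1) = z by field.
  move=> /(_ erefl erefl) /(ler_wpM2l (ltW t1)).
  rewrite mulrDr !mulrA mulrBr mulfV// mulr1 mul1r => H.
  nra.
- have gz1 : g z < g (z + 1) by apply: g_lt => //; lra.
  (* If g z < v, the chord over [z, z + 1] is still at most v at z + t, so z + t belongs to S. *)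
  pose t := Num.min 1 ((v - g z) / (g (z + 1) - g z)).
  have t0 : 0 < t by rewrite lt_min ltr01 divr_gt0// subr_gt0.
  have t1 : t <= 1 by rewrite ge_min lexx.
  have tg : t * (g (z + 1) - g z) <= v - g z.
    have : t <= (v - g z) / (g (z + 1) - g z) by rewrite /t ge_min lexx orbT.
    by rewrite ler_pdivlMr ?subr_gt0//.
  have : S (z + t).
    split; first lra.
    have := @g_cvx t (z + 1) z (ltW t0) t1.
    have -> : 0 <= z + 1 by lra.
    have -> : t * (z + 1) + (1 - t) * z = z + t by ring.
    move=> /(_ erefl z0); lra.
  by move/(ub_le_sup supS.2); rewrite -/z; lra.
Qed.

Lemma inv_on_exp_convex v : r 1 <= v ->
  1 <= inv_on `[1, +oo[ r v /\ r (inv_on `[1, +oo[ r v) = v.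
Proof.
move=> /exp_convex_surj[z z1 <-].
rewrite /inv_on pinvKV; first by [].
  move=> x y; rewrite !inE/= !in_itv/= !andbT => x1 y1 rxy.
  by case: (ltgtP x y) => // /r_incr; rewrite !in_itv/= x1 y1 => /(_ isT isT);
    rewrite rxy ltxx.
by rewrite inE/= in_itv/= z1.
Qed.

End inverse_entropy.

(** * Inverses off the range, nets of a rectangle, Lipschitz bounds *)

Lemma inv_on_out (A : set R) (f : R -> R) v : ~ (f @` A) v -> inv_on A f v = 0.
Proof.
move=> vf; pose S : set_surj A (f @` A) f := fun _ h => h.
have -> : inv_on A f v = odflt 0 ('oinv_S v) by [].
by rewrite oinv_surj; case: pselect.
Qed.

Lemma inv_onK (A : set R) (f : R -> R) x :
  (forall x y, A x -> A y -> x < y -> f x < f y) ->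
  A x -> inv_on A f (f x) = x.
Proof.
move=> f_incr Ax; rewrite /inv_on pinvKV//; last exact: mem_set.
move=> y z /set_mem Ay /set_mem Az fyz.
case: (ltgtP y z) => // yz.
  by have := f_incr _ _ Ay Az yz; rewrite fyz ltxx.
by have := f_incr _ _ Az Ay yz; rewrite fyz ltxx.
Qed.

(** Off the range the default value 0 serves; this covers the degenerate case eps0 = 0, where the
    argument of the inverse is meaningless. *)
Lemma inv_on_ge0 (r : R -> R) v : 0 <= inv_on `[1, +oo[ r v.
Proof.
have [vr|/inv_on_out->//] := pselect ((r @` `[1, +oo[) v).
have := @surjpinv_image_sub _ _ (fun=> 0) `[1, +oo[ (r @` `[1, +oo[) r
  (fun _ h => h) _ (ex_intro2 _ _ v vr erefl).
by rewrite /= in_itv/= andbT; exact: le_trans.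
Qed.

(** The net consists of centres of intervals of length 2h, except that an interval no longer than 2h
    gets its own midpoint, so that no centre leaves [a, b]. *)
Lemma interval_net (a b h : R) : a <= b -> 0 < h -> exists s : seq R,
  [/\ (size s)%:R <= (b - a) / (2 * h) + 1,
      forall z, z \in s -> a <= z <= b &
      forall x, a <= x <= b -> exists2 z, z \in s & `|x - z| <= h].
Proof.
move=> ab h0; have h20 : 0 < 2 * h by lra.
have net n : forall a, a <= b -> b - a <= 2 * h * n.+1%:R -> exists s : seq R,
  [/\ (size s <= n.+1)%N,
      forall z, z \in s -> a <= z <= b &
      forall x, a <= x <= b -> exists2 z, z \in s & `|x - z| <= h].
  elim: n => [|n IH] {}a {}ab bah.
    exists [:: (a + b) / 2]; split=> //.
      by move=> z; rewrite inE => /eqP ->; apply/andP; split; lra.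
    move=> x /andP[ax xb]; exists ((a + b) / 2); rewrite ?mem_head//.
    by rewrite ler_norml; apply/andP; split; lra.
  have [abh|abh] := leP (b - a) (2 * h).
    have [|s [s1 s2 s3]] := IH a ab.
      by rewrite (le_trans abh)// ler_peMr// ?ler1n// ltW.
    by exists s; split => //; exact: ltnW.
  have [||s [s1 s2 s3]] := IH (a + 2 * h).
  - by lra.
  - by move: bah; rewrite -[n.+2]addn1 natrD; lra.
  exists (a + h :: s); split=> //.
    move=> z; rewrite inE => /predU1P[->|/s2]; first by apply/andP; split; lra.
    by move=> /andP[? ->]; rewrite andbT; lra.
  move=> x /andP[ax xb]; have [xh|xh] := leP (a + 2 * h) x.
    by have [|z zs xz] := s3 x; [rewrite xh|exists z => //; rewrite inE zs orbT].
  exists (a + h); first by rewrite mem_head.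
  by rewrite ler_norml; apply/andP; split; lra.
have q0 : 0 <= (b - a) / (2 * h) by rewrite divr_ge0 ?subr_ge0// ltW.
have [q1 q2] := andP (truncn_itv q0).
have [||s [s1 s2 s3]] := net (Num.truncn ((b - a) / (2 * h))) a => //.
  by rewrite -ler_pdivrMl// mulrC ltW.
exists s; split => //.
apply: (@le_trans _ _ (Num.truncn ((b - a) / (2 * h))).+1%:R).
  by rewrite ler_nat.
by rewrite -addn1 natrD lerD2r.
Qed.

Lemma rectangle_net (a b c d h : R) : a <= b -> c <= d -> 0 < h ->
  exists s : seq (R * R),
  [/\ (size s)%:R <= ((b - a) / (2 * h) + 1) * ((d - c) / (2 * h) + 1),
      forall z, z \in s -> (`[a, b] `*` `[c, d]) z &
      forall p, (`[a, b] `*` `[c, d]) p ->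
        exists2 z, z \in s & Num.max `|p.1 - z.1| `|p.2 - z.2| <= h].
Proof.
move=> ab cd h0.
have [s [s1 s2 s3]] := interval_net ab h0.
have [t [t1 t2 t3]] := interval_net cd h0.
exists [seq (x, y) | x <- s, y <- t]; split.
- by rewrite size_allpairs natrM ler_pM.
- move=> z /allpairsP[[x y]/= [xs yt ->]]; split; rewrite /= in_itv/=.
    exact: s2.
  exact: t2.
- move=> [x y] [/=]; rewrite !in_itv/= => /s3[z zs xz] /t3[w wt yw].
  exists (z, w); first by apply/allpairsP; exists (z, w).
  by rewrite /= ge_max xz.
Qed.

Lemma lipschitz1_derive (f df : R ->
  R) : (forall x : R, is_derive x (1 : R) f (df x)) ->
  (forall x, `|df x| <= 1) -> forall x y, `|f x - f y| <= `|x - y|.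
Proof.
move=> fd df1.
have H x y : x <= y -> `|f y - f x| <= `|y - x|.
  move=> xy; have [|z _ ->] := @MVT_segment R f df x y xy (fun z _ => fd z).
    move=> z; apply: continuous_subspaceT => w.
    by apply/differentiable_continuous/derivable1_diffP; have [] := fd w.
  by rewrite normrM ler_piMl.
move=> x y; have [/H|/ltW/H//] := leP x y.
by rewrite distrC [leRHS]distrC.
Qed.

Lemma sin_lipschitz (x y : R) : `|sin x - sin y| <= `|x - y|.
Proof.
by apply: (@lipschitz1_derive sin cos) => z; rewrite ler_norml cos_geN1 cos_le1.
Qed.

Lemma cos_lipschitz (x y : R) : `|cos x - cos y| <= `|x - y|.
Proof.
apply: (@lipschitz1_derive cos (fun x => - sin x)) => z.
by rewrite ler_norml lerNl opprK lerNl sin_le1 sin_geN1.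
Qed.

(** * Admissible functions and the kernel *)

Section admissible_function.
Variables (phi Z : R -> R) (u0 : R).
Hypothesis Z_adm : admissible phi Z u0.

Lemma admissible_incr u v : 0 <= u -> u < v -> Z u < Z v.
Proof.
move=> u_ge0 uv; have [[_ + _ _] _] := Z_adm; apply => //; rewrite in_itv/= andbT//.
by rewrite (le_trans u_ge0)// ltW.
Qed.

Lemma admissible_le u v : 0 <= u -> u <= v -> Z u <= Z v.
Proof.
move=> u_ge0; rewrite le_eqVlt => /predU1P[->//|/(admissible_incr u_ge0)].
exact: ltW.
Qed.

Lemma admissible_gt0 u : 0 < u -> 0 < Z u.
Proof. by have [[_ _ + _] _] := Z_adm; apply. Qed.

Lemma admissible_u0 : 0 <= u0.
Proof. by have [_ []] := Z_adm. Qed.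

Lemma admissible_surj v w : 0 <= v -> Z v <= w -> exists2 u, v <= u & Z u = w.
Proof.
move=> v0 Zvw; have [[Zc _ _ Zy] _] := Z_adm.
have [M [_ ZM]] : \forall u \near +oo, w <= Z u.
  by move/cvgryPge : Zy; exact.
pose m := Num.max v (M + 1).
have wZ : w <= Z m by apply: ZM; rewrite lt_max ltrDl ltr01 orbT.
have vm : v <= m by rewrite le_max lexx.
have [||u uvm <-] := @IVT R Z v m w vm.
- apply: continuous_subspaceW Zc => x /=; rewrite !in_itv/= andbT.
  by move=> /andP[vx _]; exact: le_trans vx.
- by rewrite ge_min Zvw le_max wZ orbT.
by exists u => //; move: uvm; rewrite in_itv/= => /andP[].
Qed.

(** Only the point 0 is at stake, positivity being assumed on ]0, +oo[. A negative value there would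
    force, by the intermediate value theorem, a zero of Z at a positive point. *)
Lemma admissible_ge0 u : 0 <= u -> 0 <= Z u.
Proof.
move=> u_ge0; rewrite leNgt; apply/negP => Zu.
have [v uv Zv] := admissible_surj u_ge0 (ltW Zu).
have : u < v by rewrite lt_neqAle uv andbT; apply: contraTneq Zu => ->;
  rewrite Zv ltxx.
move=> {}uv; have : 0 < Z ((u + v) / 2) by apply: admissible_gt0; lra.
have : Z ((u + v) / 2) < Z v by apply: admissible_incr; lra.
by rewrite Zv; lra.
Qed.

Lemma admissible_inv_onK u : 0 <= u -> inv_on `[0, +oo[ Z (Z u) = u.
Proof.
move=> u_ge0; apply: inv_onK; rewrite /= ?in_itv/= ?u_ge0// => x y.
by rewrite !in_itv/= andbT => x0 _; exact: admissible_incr.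
Qed.

(* Monotonicity of [u / Z u] beyond [u0] turns the bound [min 1 (h * p)] into
   a ratio of values of [Z]. *)
Lemma admissible_ratio h p m : 0 < h -> 0 <= p -> m <= 1 -> m <= h * p ->
  m <= Z (p + u0) / Z (1 / h + u0).
Proof.
move=> h0 p0 m1 mp; have u0_ge0 := admissible_u0.
have q0 : 0 < 1 / h by rewrite divr_gt0.
have Zq : 0 < Z (1 / h + u0) by apply: admissible_gt0; lra.
rewrite ler_pdivlMr//.
have [qp|pq] := leP (1 / h) p.
  apply: (@le_trans _ _ (Z (1 / h + u0))); first by rewrite ler_piMl// ltW.
  by apply: admissible_le; lra.
(* The ratio is monotone on the open half-line beyond [u0], which excludes the argument p + u0 when
   p = 0. *)
have [p_eq0|p_neq0] := eqVneq p 0.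
  move: mp; rewrite p_eq0 mulr0 add0r => mp; apply: (@le_trans _ _ 0);
    last exact: admissible_ge0.
  by apply: mulr_le0_ge0 (ltW Zq).
have p_gt0 : 0 < p by rewrite lt_neqAle eq_sym p_neq0.
have Zp : 0 < Z (p + u0) by apply: admissible_gt0; lra.
have [_ [_ ratio _]] := Z_adm.
have := ratio (p + u0) (1 / h + u0).
rewrite !in_itv/= !andbT !ltrDr lerD2r => /(_ p_gt0 q0 (ltW pq)).
rewrite ler_pdivrMr// mulrAC ler_pdivlMr// => H.
have hq : h * (1 / h) = 1 by rewrite mulrC divfK// gt_eqF.
apply: (@le_trans _ _ (h * p * Z (1 / h + u0))); first by rewrite ler_pM2r.
have -> : Z (p + u0) = h * (1 / h * Z (p + u0)) by rewrite mulrA hq mul1r.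
rewrite -mulrA ler_pM2l//.
have : Z (p + u0) <= Z (1 / h + u0) by apply: admissible_le; lra.
move=> /(ler_wpM2l u0_ge0); set q := 1 / h in H *; lra.
Qed.

End admissible_function.

Lemma dist_kernelI (phi kappa : R -> R) N ak (Z : R -> R) u0 t x t' x' h l :
  kappa = cos \/ kappa = sin -> admissible phi Z u0 -> 0 < h ->
  `|t - t'| <= h -> `|x - x'| <= h ->
  `|kernelI kappa N ak t x l - kernelI kappa N ak t' x' l| <=
    2 / Z (1 / h + u0) * weight N ak Z u0 l.
Proof.
move=> kcs Zadm h0 tt' xx'; rewrite /kernelI /weight.
set s := symbol N ak l.
set A := l * x + t * s; set B := l * x' + t' * s.
have k2 : `|kappa A - kappa B| <= 2.
  case: kcs => ->.
    have := cos_geN1 A; have := cos_geN1 B; have := cos_le1 A; have := cos_le1 B.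
    by move=> *; rewrite ler_norml; apply/andP; split; lra.
  have := sin_geN1 A; have := sin_geN1 B; have := sin_le1 A; have := sin_le1 B.
  by move=> *; rewrite ler_norml; apply/andP; split; lra.
have kl : `|kappa A - kappa B| <= h * `|l| + h * `|s|.
  apply: (@le_trans _ _ `|A - B|).
    by case: kcs => ->; [exact: cos_lipschitz|exact: sin_lipschitz].
  have -> : A - B = (x - x') * l + (t - t') * s by rewrite /A /B; ring.
  by rewrite (le_trans (ler_normD _ _))// !normrM lerD// ler_wpM2r.
(* min(2, h|l| + h|s|) is at most 2 m1 + 2 m2: this split is the origin of the halves in [weight]
   and of the factor 2. *)
pose m1 := Num.min 1 (h * (`|l| / 2)); pose m2 := Num.min 1 (h * (`|s| / 2)).
have b1 : m1 <= Z (`|l| / 2 + u0) / Z (1 / h + u0).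
  by apply: (admissible_ratio Zadm); rewrite ?divr_ge0// ge_min lexx ?orbT.
have b2 : m2 <= Z (`|s| / 2 + u0) / Z (1 / h + u0).
  by apply: (admissible_ratio Zadm); rewrite ?divr_ge0// ge_min lexx ?orbT.
rewrite mulrAC mulrDr mulrDl.
apply: (@le_trans _ _ (2 * m1 + 2 * m2)); last by lra.
have l0 := normr_ge0 l; have s0 := normr_ge0 s.
have hl : 0 <= h * (`|l| / 2) by rewrite mulr_ge0 ?divr_ge0// ltW.
have hs : 0 <= h * (`|s| / 2) by rewrite mulr_ge0 ?divr_ge0// ltW.
rewrite /m1 /m2; case: (leP 1 (h * (`|l| / 2))) => ?;
  case: (leP 1 (h * (`|s| / 2))) => ?; lra.
Qed.

End RealAnalysis.

Lemma le_right_limit {R : realType} (g : R -> R) (e m : R) :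
  {for e, continuous g} -> (forall x, e < x -> m <= g x) -> m <= g e.
Proof.
move=> gc mg; apply: (@ler_cvg_to R (e^'+) _ R (fun=> m) g m (g e)).
- exact: cvg_cst.
- exact: cvg_at_right_filter.
- by near=> x; apply: mg.
Unshelve. all: by end_near. Qed.

(** * Exponential moments and their stability under mean-square limits *)

Section MomentGeneratingFunctions.
Context {d : measure_display} {Omega : measurableType d} {R : realType}.
Variable P : probability Omega R.
Implicit Types (phi : R -> R) (X Y : {RV P >-> R}).

(** For e >= 0 this is equivalent to tau phi X <= e, but it is free of the infimum and allows the
    parameter 0, which [tau] reaches only as a limit. *)
Definition mgf_le phi (X : Omega -> R) (e : R) : Prop :=
  forall l, ('M_P X l <= (expR (phi (e * l)))%:E)%E.

Lemma mgf_leW phi X e e' : Orlicz_Nfunction phi -> 0 <= e -> e <= e' ->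
  mgf_le phi X e -> mgf_le phi X e'.
Proof.
move=> phiN e0 ee' Xe l; apply: (le_trans (Xe l)).
rewrite lee_fin ler_expR Nfunction_le// !normrM.
by rewrite ler_wpM2r// !ger0_norm// (le_trans e0).
Qed.

Lemma tau_ge0 phi X : (0 <= tau phi X)%E.
Proof. by apply: le_ereal_inf_tmp => _ [a [a0 _] <-]; rewrite lee_fin ltW. Qed.

Lemma mmt_gen_fun_ge0 X l : (0 <= 'M_P X l)%E.
Proof. by apply: expectation_ge0 => x; exact: expR_ge0. Qed.

(** The infimum is attained: the bound holds for every e' > e, and continuity of [phi] lets e'
    decrease to e. *)
Lemma tau_le_mgf_le phi X e : Orlicz_Nfunction phi ->
  (tau phi X <= e%:E)%E -> mgf_le phi X e.
Proof.
move=> phiN tauX l.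
have e0 : 0 <= e by rewrite -lee_fin (le_trans (tau_ge0 phi X)).
have M e' : e < e' -> ('M_P X l <= (expR (phi (e' * l)))%:E)%E.
  move=> ee'; have : (tau phi X < e'%:E)%E by rewrite (le_lt_trans tauX)// lte_fin.
  move=> /ereal_inf_lt[_ [a [a0 aX] <-]]; rewrite lte_fin => ae'.
  apply: (mgf_leW (e := a)) => //; exact: ltW.
have [m Mm] : exists m, 'M_P X l = m%:E.
  have := M (e + 1); rewrite ltrDl ltr01 => /(_ isT).
  case: ('M_P X l) (mmt_gen_fun_ge0 X l) => [m| |]//; by exists m.
rewrite Mm lee_fin; apply: (@le_right_limit _ (fun e => expR (phi (e * l)))).
  have [[phic _ _] _] := phiN.
  apply: continuous_comp; last exact: continuous_expR.
  apply: continuous_comp; last exact: phic.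
  exact: mulrr_continuous.
by move=> x ex; rewrite -lee_fin -Mm; exact: M.
Qed.

Lemma mgf_le_tau_le phi X e : Orlicz_Nfunction phi -> 0 <= e ->
  mgf_le phi X e -> (tau phi X <= e%:E)%E.
Proof.
move=> phiN e0 Xe; apply/lee_addgt0Pr => r r0; rewrite -EFinD.
apply: ereal_inf_lbound; exists (e + r) => //; split; first by rewrite ltr_wpDl.
by apply: mgf_leW Xe => //; rewrite lerDl ltW.
Qed.

(** From exp(l|X|) <= exp(lX) + exp(-lX) and the evenness of [phi]. This is where the leading 2 of
    the final bound comes from. *)
Lemma mgf_le_abs phi X e (l : R) : Orlicz_Nfunction phi -> mgf_le phi X e ->
  (\int[P]_w (expR (l * `|X w|))%:E <= (2 * expR (phi (e * l)))%:E)%E.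
Proof.
move=> phiN Xe.
have mE (k : R) : measurable_fun setT (fun w => (expR (X w * k))%:E).
  apply/measurable_EFinP; apply: measurableT_comp => //.
  exact: measurable_funM.
apply: (@le_trans _ _ (\int[P]_w ((expR (X w * l))%:E + (expR (X w * - l))%:E))%E).
  apply: ge0_le_integral => //.
  - apply/measurable_EFinP; apply: measurableT_comp => //.
    by apply: measurable_funM => //; exact: measurableT_comp.
  - exact: emeasurable_funD.
  - move=> w _; rewrite -EFinD lee_fin; case: (ger0P (X w)) => _.
      by rewrite mulrC lerDl expR_ge0.
    by rewrite (_ : l * - X w = X w * - l) ?lerDr ?expR_ge0//; ring.
rewrite ge0_integralD//.
rewrite mulr_natl mulr2n EFinD leeD//.
  by have := Xe l; rewrite /mmt_gen_fun unlock.
have := Xe (- l); rewrite /mmt_gen_fun unlock.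
by have [[_ ev _] _] := phiN; rewrite mulrN ev.
Qed.

Lemma measurable_norm_gt X (u : R) : measurable [set w | u < `|X w|].
Proof.
rewrite (_ : [set _ | _] = (fun w => `|X w|) @^-1` `]u, +oo[); last first.
  by apply/seteqP; split => w /=; rewrite in_itv/= andbT.
rewrite -[X in measurable X]setTI.
have mX : measurable_fun setT (fun w => `|X w|) by exact: measurableT_comp.
exact: mX.
Qed.

Lemma markov_expR_abs X (u l B : R) : 0 <= l ->
  (\int[P]_w (expR (l * `|X w|))%:E <= B%:E)%E ->
  (P [set w | (u < `|X w|)%R] <= (B * expR (- (l * u)))%:E)%E.
Proof.
move=> l0 XB; set A := [set _ | _].
have mA : measurable A := measurable_norm_gt X u.
have mE : measurable_fun setT (fun w => (expR (l * `|X w|))%:E).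
  apply/measurable_EFinP; apply: measurableT_comp => //.
  by apply: measurable_funM => //; exact: measurableT_comp.
rewrite expRN EFinM lee_pdivlMr ?expR_gt0//.
apply: le_trans XB; rewrite muleC.
rewrite -[A in P A]setIT -integral_indic//.
rewrite -ge0_integralZl//; last exact/measurable_EFinP.
apply: ge0_le_integral => //.

- apply/measurable_EFinP; exact: measurable_funM.
move=> w _; rewrite -EFinM lee_fin indicE; have [|_] := boolP (w \in A); last first.
  by rewrite mulr0 expR_ge0.
rewrite inE/= => uX; rewrite mulr1 ler_expR ler_wpM2l// ltW//.
Qed.

(** The rate is summable, so the sum of the squared differences is integrable, hence finite almost
    everywhere, and its terms tend to 0 without passing to a subsequence. *)
Lemma ms_dist2_cvg_ae (S : nat -> {RV P >-> R}) X :
  (forall n, (ms_dist2 P (S n) X <= (1 / (2 ^ n.+1)%:R)%:E)%E) ->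
  {ae P, forall w, S n w @[n --> \oo] --> X w}.
Proof.
move=> SX; pose F n w := ((S n w - X w) ^+ 2)%:E.
have mF n : measurable_fun setT (F n).
  by apply/measurable_EFinP; apply: measurable_funX; exact: measurable_funB.
have F0 n w : (0 <= F n w)%E by rewrite lee_fin sqr_ge0.
pose G w := (\sum_(0 <= n <oo) F n w)%E.
have mG : measurable_fun setT G by exact: ge0_emeasurable_sum.
have intG : P.-integrable setT G.
  apply/integrableP; split => //.
  under eq_integral do rewrite gee0_abs ?nneseries_ge0//.
  rewrite integral_nneseries//.
  apply: (@le_lt_trans _ _ (\sum_(0 <= n <oo) (1 / (2 ^ (n + 1))%:R : R)%:E)%E).
    apply: lee_nneseries => [n _ _|n _]; first exact: integral_ge0.
    by have := SX n; rewrite /ms_dist2 unlock addn1.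
  have := @cvg_geometric_eseries_half R 1 0.
  by rewrite expr0 => /cvg_lim ->//; rewrite ltry.
have := integrable_ae measurableT intG.
apply: filterS => w /(_ I) Gw.
have F_cvg : F n w @[n --> \oo] --> 0%E.
  have Glt : (G w < +oo)%E by rewrite ltey_eq Gw.
  have tail := @nneseries_tail_cvg R (F ^~ w) xpredT Glt (fun n _ => F0 n w).
  apply: (@squeeze_cvge _ _ _ _ (cst 0%E) _ (fun n => \sum_(n <= k <oo) F k
    w)%E) => //.
  - near=> n; rewrite F0/=.
    have := @nneseries_lim_ge R (F ^~ w) xpredT n n.+1 (fun k _ _ => F0 k w).
    by rewrite big_nat1.
  - exact: cvg_cst.
have : (S n w - X w) ^+ 2 @[n --> \oo] --> (0 : R).
  by move/fine_cvg : F_cvg.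
move=> sq0; have := continuous_cvg _ (@sqrt_continuous R 0) sq0.
rewrite sqrtr0 /comp; under eq_fun do rewrite sqrtr_sqr.
by move=> SX0; apply/subr_cvg0; apply: norm_cvg0; exact: SX0.
Unshelve. all: by end_near. Qed.

Lemma mgf_le_lim phi (S : nat -> {RV P >-> R}) X (en : nat -> R) e :
  Orlicz_Nfunction phi ->
  (forall n, (ms_dist2 P (S n) X <= (1 / (2 ^ n.+1)%:R)%:E)%E) ->
  en n @[n --> \oo] --> e -> (forall n, mgf_le phi (S n) (en n)) ->
  mgf_le phi X e.
Proof.
move=> phiN SX ene Sen l.
have mE (Y : {RV P >-> R}) : measurable_fun setT (fun w => (expR (Y w * l))%:E).
  by apply/measurable_EFinP; apply: measurableT_comp => //; exact: measurable_funM.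
have E0 (Y : {RV P >-> R}) w : (0 <= (expR (Y w * l))%:E)%E by rewrite lee_fin
  expR_ge0.
have fat := @fatou _ _ _ P setT measurableT (fun n w => (expR (S n w * l))%:E)
  (fun n => mE (S n)) (fun n w _ => E0 _ w).
have phie : (expR (phi (en n * l)))%:E @[n --> \oo] --> (expR (phi (e * l)))%:E.
  apply: cvg_EFin; first by near=> n.
  apply: continuous_cvg; first exact: continuous_expR.
  have [[phic _ _] _] := phiN.
  apply: continuous_cvg; first exact: phic.
  exact: cvgMl.
apply: (@le_trans _ _ (limn_einf (fun n => \int[P]_w (expR (S n w *
  l))%:E)%E)); last first.
  rewrite -(cvg_limn_einf_sup phie).1 !limn_einf_lim.
  apply: lee_lim; [exact: is_cvg_einfs|exact: is_cvg_einfs|].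
  near=> n; apply: le_ereal_inf_tmp => _ [k nk <-]; apply: ge_ereal_inf.
  exists (\int[P]_w (expR (S k w * l))%:E)%E; first by exists k.
  by have := Sen k l; rewrite /mmt_gen_fun unlock.
apply: le_trans fat; rewrite /mmt_gen_fun unlock.
apply: ae_ge0_le_integral => //.
- by move=> w _; exact: (E0 X).
- exact: (mE X).
- move=> w _; rewrite limn_einf_lim; apply: lime_ge; first exact: is_cvg_einfs.
  by near=> n; apply: le_ereal_inf_tmp => _ [k nk <-].
- rewrite (_ : (fun=> _) =
    (fun w => - limn_esup (fun n => - (expR (S n w * l))%:E))%E); last first.
    apply/funext => w; rewrite -limn_einfN; congr limn_einf.
    by apply/funext => n /=; rewrite opprK.
  apply: measurableT_comp => //; apply: measurable_fun_limn_esup => n.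
  by apply: measurableT_comp => //; exact: mE.
apply: filterS (ms_dist2_cvg_ae SX) => w Sw _.
suff /cvg_limn_einf_sup[-> _] :
  (expR (S n w * l))%:E @[n --> \oo] --> (expR (X w * l))%:E by [].
apply: cvg_EFin; first by near=> n.
apply: continuous_cvg; first exact: continuous_expR.
exact: cvgMl.
Unshelve. all: by end_near. Qed.

End MomentGeneratingFunctions.

(** * Tagged partitions: existence, shift, concatenation *)

Section Partitions.
Context {R : realType}.
Implicit Types (x xi : nat -> R).

Definition tagged_partition (al be delta : R) n x xi : Prop :=
  [/\ x 0%N = al, x n = be,
      forall i, (i < n)%N -> x i <= xi i <= x i.+1 &
      forall i, (i < n)%N -> x i.+1 - x i < delta].

Lemma tagged_partition_exists al be delta : al <= be -> 0 < delta ->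
  exists n x xi, tagged_partition al be delta n x xi.
Proof.
move=> albe d0; have q0 : 0 <= (be - al) / delta by rewrite divr_ge0
  ?subr_ge0// ltW.
have [_ qn] := andP (truncn_itv q0).
set n := (Num.truncn ((be - al) / delta)).+1 in qn.
have n0 : 0 < n%:R :> R by rewrite ltr0n.
have n_neq0 : n%:R != 0 :> R by rewrite gt_eqF.
have st i : (al + (be - al) * i.+1%:R / n%:R) - (al + (be - al) * i%:R / n%:R)
  = (be - al) / n%:R.
  by rewrite -addn1 natrD; field.
have st0 : 0 <= (be - al) / n%:R by rewrite divr_ge0 ?subr_ge0// ltW.
exists n, (fun i => al + (be - al) * i%:R / n%:R),
  (fun i => al + (be - al) * i%:R / n%:R).
split; first by rewrite mulr0 mul0r addr0.
- by rewrite mulfK// addrC subrK.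
- by move=> i _; rewrite lexx/= -subr_ge0 st.
- by move=> i _; rewrite st ltr_pdivrMr// mulrC -ltr_pdivrMr.
Qed.

Lemma tagged_partition_mono al be delta n x xi :
  tagged_partition al be delta n x xi ->
  forall i j, (i <= j)%N -> (j <= n)%N -> x i <= x j.
Proof.
move=> [_ _ xix _] i; elim=> [|j IH] ij jn; first by move: ij;
  rewrite leqn0 => /eqP ->.
move: ij; rewrite leq_eqVlt => /predU1P[->//|ij].
apply: le_trans (IH ij (ltnW jn)) _.
by have /andP[/le_trans] := xix j jn; apply.
Qed.

Lemma tagged_partition_shift al be delta n x xi h :
  tagged_partition al be delta n x xi ->
  tagged_partition (al + h) (be + h) delta n (fun i => x i + h) (fun i => xi i + h).
Proof.
move=> [x0 xn xxi xd]; split; rewrite ?x0 ?xn// => i ilt.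
  by rewrite !lerD2r xxi.
by have := xd i ilt; lra.
Qed.

Lemma tagged_partitionW al be delta delta' n x xi : delta <= delta' ->
  tagged_partition al be delta n x xi -> tagged_partition al be delta' n x xi.
Proof.
by move=> dd [? ? ? xd]; split => // i /xd /lt_le_trans; apply.
Qed.

Definition fun_cat n (x x' : nat -> R) : nat -> R :=
  fun i => if (i < n)%N then x i else x' (i - n)%N.

Lemma fun_catl n x x' i : (i < n)%N -> fun_cat n x x' i = x i.
Proof. by rewrite /fun_cat => ->. Qed.

Lemma fun_catr n x x' i : fun_cat n x x' (n + i) = x' i.
Proof. by rewrite /fun_cat ltnNge leq_addr/= addKn. Qed.

Lemma fun_catS n x x' i : x n = x' 0%N -> (i < n)%N -> fun_cat n x x' i.+1 = x i.+1.
Proof.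
move=> xx' ilt; rewrite /fun_cat; case: ltnP => // ni.
have -> : n = i.+1 by apply/eqP; rewrite eqn_leq ni ilt.
by rewrite subnn -xx'; congr x; apply/eqP; rewrite eqn_leq ni ilt.
Qed.

Lemma tagged_partition_cat al mi be delta n m x x' xi xi' :
  tagged_partition al mi delta n x xi -> tagged_partition mi be delta m x' xi' ->
  tagged_partition al be delta (n + m) (fun_cat n x x') (fun_cat n xi xi').
Proof.
move=> [x0 xn xxi xd] [x0' xn' xxi' xd'].
have xx' : x n = x' 0%N by rewrite xn x0'.
split.
- by rewrite /fun_cat; case: ltnP => //; rewrite leqn0 => /eqP n0;
  rewrite n0 x0' -xn n0.
- by rewrite fun_catr.
- move=> i inm; have [ilt|ni] := ltnP i n.
    by rewrite fun_catS// !fun_catl// xxi.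
  rewrite -(subnKC ni) -addnS !fun_catr; apply: xxi'.
  by rewrite ltn_subLR.
- move=> i inm; have [ilt|ni] := ltnP i n.
    by rewrite fun_catS// !fun_catl// xd.
  rewrite -(subnKC ni) -addnS !fun_catr; apply: xd'.
  by rewrite ltn_subLR.
Qed.

End Partitions.

(** * Mean-square integrals, uniformly in a shift of the partition *)

Section MeanSquare.
Context {d : measure_display} {Omega : measurableType d} {R : realType}.
Variable P : probability Omega R.
Implicit Types (f g : R -> R) (y : R -> {RV P >-> R}).

Lemma RS_sum_cat f y n m x x' xi xi' w : x n = x' 0%N ->
  RS_sum f y (n + m) (fun_cat n x x') (fun_cat n xi xi') w =
  RS_sum f y n x xi w + RS_sum f y m x' xi' w.
Proof.
move=> xx'; rewrite /RS_sum big_split_ord/=; congr (_ + _).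
  by apply: eq_bigr => i _; rewrite fun_catS// !fun_catl.
by apply: eq_bigr => i _; rewrite -addnS !fun_catr.
Qed.

Lemma measurable_RS_sum f y n x xi :
  measurable_fun setT (RS_sum f y n x xi).
Proof.
apply: measurable_sum => i; apply: measurable_funM => //.
exact: measurable_funB.
Qed.

Lemma ms_dist2C (X Y : Omega -> R) : ms_dist2 P X Y = ms_dist2 P Y X.
Proof.
by congr ('E_P[_])%E; apply/funext => w; rewrite -sqrrN opprB.
Qed.

Lemma expectation_sqrD (X Y : Omega -> R) :
  measurable_fun setT X -> measurable_fun setT Y ->
  ('E_P[fun w => ((X w + Y w) ^+ 2)%R] <=
     2%:E * 'E_P[fun w => (X w ^+ 2)%R] + 2%:E * 'E_P[fun w => (Y w ^+ 2)%R])%E.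
Proof.
move=> mX mY; rewrite unlock.
have mE (Z : Omega -> R) : measurable_fun setT Z ->
    measurable_fun setT (fun w => (Z w ^+ 2)%:E).
  by move=> mZ; apply/measurable_EFinP; exact: measurable_funX.
have E0 (Z : Omega -> R) w : (0 <= (Z w ^+ 2)%:E)%E by rewrite lee_fin sqr_ge0.
rewrite -!ge0_integralZl//; [|exact: mE..].
rewrite -ge0_integralD//.
- apply: ge0_le_integral => //.
  + by move=> w _; exact: (E0 (fun w => X w + Y w)).
  + by apply: (mE (fun w => X w + Y w)); exact: measurable_funD.
  + by apply: emeasurable_funD; apply: emeasurable_funM => //; exact: mE.
  + move=> w _; rewrite -!EFinM -EFinD lee_fin.
    by have := sqr_ge0 (X w - Y w); rewrite !expr2; nra.
- by move=> w _; rewrite mule_ge0.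
- by apply: emeasurable_funM => //; exact: mE.
- by move=> w _; rewrite mule_ge0.
- by apply: emeasurable_funM => //; exact: mE.
Qed.

Lemma ms_dist2_triangle (Y X Z : Omega -> R) (e e' : R) : measurable_fun setT X ->
  measurable_fun setT Y -> measurable_fun setT Z ->
  (ms_dist2 P X Y < e%:E)%E -> (ms_dist2 P Y Z < e'%:E)%E ->
  (ms_dist2 P X Z < (2 * e + 2 * e')%:E)%E.
Proof.
move=> mX mY mZ XY YZ.
have := @expectation_sqrD (fun w => X w - Y w) (fun w => Y w - Z w).
move=> /(_ (measurable_funB mX mY) (measurable_funB mY mZ)).
under [X in ('E_P[X] <= _)%E]eq_fun do rewrite addrA subrK.
move=> /le_lt_trans; apply.
rewrite (_ : (2 * e + 2 * e')%:E = (2%:E * e%:E + 2%:E * e'%:E)%E)//.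
by apply: lteD; rewrite lte_pmul2l.
Qed.

(** Truncation and mesh limits are merged, and one [delta] serves all shifts h in [0, 1]; this is
    the form in which the right limits of [LS_bimeasure] can be taken. *)
Definition RS_approx f y (X : Omega -> R) : Prop :=
  forall e : R, 0 < e -> exists A : R, forall al be : R, al < - A -> A < be ->
    exists2 delta : R, 0 < delta & forall (h : R) n x xi, 0 <= h -> h <= 1 ->
      tagged_partition al be delta n x xi ->
      (ms_dist2 P (RS_sum f y n (fun i => x i + h)%R (fun i => xi i + h)%R) X <
        e%:E)%E.

(* The integral over [[al + h, be + h]] is approximated uniformly in [h]:
   sums over partitions of [[al + h, be + h]] differ by as much as sums over
   their extensions to [[al, be + 1]] by common pieces. *)
Lemma ms_integral_RS_approx f y (X : {RV P >-> R}) :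
  is_ms_integral f y X -> RS_approx f y X.
Proof.
move=> [J [J_on JX]] e e0.
have e1 : 0 < e / 32 by lra.
have [A0 JA] := JX _ e1.
(* The 0 ensures al < be; the extra 1 keeps al + h below -A0 for every h up to 1. *)
exists (Num.max 0 (A0 + 1)) => al be alA Abe.
have [A1 A2] : 0 <= Num.max 0 (A0 + 1) /\ A0 + 1 <= Num.max 0 (A0 + 1).
  by rewrite !le_max !lexx orbT.
have albe1 : al < be + 1 by lra.
have [delta delta0 Jd] := J_on _ _ albe1 _ e1.
exists delta => // h n x xi h0 h1 xP.
have := tagged_partition_shift h xP; move=> {xP}.
set x' := (fun i => x i + h); set xi' := (fun i => xi i + h) => xP.
have albeh : al + h < be + h by lra.
(* [dh] depends on h whereas [delta] must not. A partition z finer than both mediates: it is near x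
   by the integral over [al, be + 1], and near X by the one over [al + h, be + h]. *)
have [dh dh0 Jh] := J_on _ _ albeh _ e1.
have dm : 0 < Num.min dh delta by rewrite lt_min dh0 delta0.
have [m [z [zi zP]]] := tagged_partition_exists (ltW albeh) dm.
have zPd := tagged_partitionW (_ : Num.min dh delta <= delta) zP.
have [|nl [l [li lP]]] := @tagged_partition_exists _ al (al + h) delta _
  delta0; first lra.
have [|nr [q [qi qP]]] := @tagged_partition_exists _ (be + h) (be + 1) delta _
  delta0; first lra.
have close k v vi : tagged_partition (al + h) (be + h) delta k v vi ->
  (ms_dist2 P (fun w => RS_sum f y nl l li w + (RS_sum f y k v vi w + RS_sum f
    y nr q qi w))%R
    (J al (be + 1)%R) < (e / 32)%:E)%E.
  move=> vP.
  have vqP := tagged_partition_cat vP qP.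
  have lvqP := tagged_partition_cat lP vqP.
  have [c0 cn ci cd] := lvqP.
  have [l0 ln _ _] := lP; have [v0 vn _ _] := vP; have [q0 qn _ _] := qP.
  have [vq0 _ _ _] := vqP.
  have := Jd _ _ _ c0 cn ci cd; congr (_ < _)%E.
  congr ('E_P[_])%E; apply/funext => w.
  by rewrite RS_sum_cat ?ln// RS_sum_cat// vn.
have mRS := measurable_RS_sum f y.
have mLR k v vi : measurable_fun setT (fun w => RS_sum f y nl l li w + (RS_sum
  f y k v vi w + RS_sum f y nr q qi w)).
  by apply: measurable_funD => //; exact: measurable_funD.
have xz : (ms_dist2 P (RS_sum f y n x' xi') (RS_sum f y m z zi) < (e / 8)%:E)%E.
  have := close _ _ _ xP.
  have := close _ _ _ (zPd ltac:(by rewrite ge_min lexx orbT)); rewrite ms_dist2C.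
  move=> /[swap] /(ms_dist2_triangle (mLR _ _ _) (measurable_funPT _) (mLR _ _
    _)) /[apply].
  rewrite (_ : 2 * (e / 32) + 2 * (e / 32) = e / 8); last by lra.
  congr (_ < _)%E; congr ('E_P[_])%E; apply/funext => w; congr (_ ^+ 2); ring.
have zJ : (ms_dist2 P (RS_sum f y m z zi) (J (al + h)%R (be + h)%R) < (e /
  32)%:E)%E.
  have [z0 zn zz zd] := zP; apply: Jh => // i im.
  by apply: (lt_le_trans (zd i im)); rewrite ge_min lexx.
have JhX : (ms_dist2 P (J (al + h)%R (be + h)%R) X < (e / 32)%:E)%E.
  by apply: JA; lra.
have zX := ms_dist2_triangle (mRS _ _ _) (measurable_funPT _) (measurable_funPT
  _) zJ JhX.
have := ms_dist2_triangle (mRS _ _ _) (mRS _ _ _) (measurable_funPT _) xz zX.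
by move=> /lt_le_trans; apply; rewrite lee_fin; lra.
Qed.

Lemma RS_approxB f g y (X Y : {RV P >-> R}) : RS_approx f y X -> RS_approx g y Y ->
  RS_approx (fun l => f l - g l) y (fun w => X w - Y w).
Proof.
move=> fX gY e e0; have e4 : 0 < e / 4 by lra.
have [A1 fX1] := fX _ e4; have [A2 gY1] := gY _ e4.
exists (Num.max A1 A2) => al be al1 be1.
have [M1 M2] : A1 <= Num.max A1 A2 /\ A2 <= Num.max A1 A2.
  by rewrite !le_max !lexx orbT.
have [||d1 d10 fX2] := fX1 al be; [lra..|].
have [||d2 d20 gY2] := gY1 al be; [lra..|].
exists (Num.min d1 d2) => [|h n x xi h0 h1 xP]; first by rewrite lt_min d10.
have xP1 := tagged_partitionW (_ : Num.min d1 d2 <= d1) xP.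
have xP2 := tagged_partitionW (_ : Num.min d1 d2 <= d2) xP.
have := fX2 h n x xi h0 h1 (xP1 ltac:(by rewrite ge_min lexx)).
have := gY2 h n x xi h0 h1 (xP2 ltac:(by rewrite ge_min lexx orbT)).
set x' := (fun i => x i + h); set xi' := (fun i => xi i + h) => gd fd.
have mRS := measurable_RS_sum.
have := @expectation_sqrD (fun w => RS_sum f y n x' xi' w - X w)
  (fun w => - (RS_sum g y n x' xi' w - Y w)).
have m1 : measurable_fun setT (fun w => RS_sum f y n x' xi' w - X w) by exact:
  measurable_funB.
have m2 : measurable_fun setT (fun w => RS_sum g y n x' xi' w - Y w) by exact:
  measurable_funB.
move=> /(_ m1 (measurableT_comp (@oppr_measurable R setT) m2)).
under [X in (_ <= _ + _ * 'E_P[X])%E]eq_fun do rewrite sqrrN.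
have -> : (fun w => (RS_sum f y n x' xi' w - X w - (RS_sum g y n x' xi' w - Y
  w)) ^+ 2) =
  (fun w => (RS_sum (fun l => f l - g l) y n x' xi' w - (X w - Y w)) ^+ 2).
  apply/funext => w; congr (_ ^+ 2).
  rewrite (_ : RS_sum (fun l => f l - g l) y n x' xi' w =
    RS_sum f y n x' xi' w - RS_sum g y n x' xi' w); first by ring.
  by rewrite /RS_sum -sumrB; apply: eq_bigr => i _; rewrite mulrBl.
move=> /le_lt_trans; apply.
have -> : e = 2 * (e / 4) + 2 * (e / 4) by lra.
rewrite [ltRHS](_ : _ = (2%:E * (e / 4)%:E + 2%:E * (e / 4)%:E)%E)//.
by apply: lteD; rewrite lte_pmul2l.
Qed.

End MeanSquare.

(** * Second moments of Riemann-Stieltjes sums *)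

Section SecondMoments.
Context {d : measure_display} {Omega : measurableType d} {R : realType}.
Variable P : probability Omega R.
Implicit Types (phi f g : R -> R) (y : R -> {RV P >-> R}) (X Y : {RV P >-> R}).

Lemma sqr_le_expR (x : R) : x ^+ 2 <= 4 * expR `|x|.
Proof.
have x0 := normr_ge0 x; rewrite -real_normK ?num_real//.
have := expR_ge1Dx (`|x| / 2); rewrite [in expR `|x|](_ : `|x| = `|x| / 2 +
  `|x| / 2); last by lra.
by rewrite expRD; set u := expR _; rewrite expr2 => H; nra.
Qed.

Lemma sub_gaussian_integrable_sqr phi X : Orlicz_Nfunction phi ->
  sub_gaussian phi X -> P.-integrable setT (fun w => (X w ^+ 2)%:E).
Proof.
move=> phiN [_ _ [a a0 Xa]].
have Xa' : mgf_le P phi X a by move=> l; rewrite mulrC.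
have mX2 : measurable_fun setT (fun w => (X w ^+ 2)%:E).
  by apply/measurable_EFinP; exact: measurable_funX.
apply/integrableP; split => //.
have mE : measurable_fun setT (fun w => (expR `|X w|)%:E).
  by apply/measurable_EFinP; apply: measurableT_comp => //; exact: measurableT_comp.
apply: (@le_lt_trans _ _ (4%:E * \int[P]_w (expR (1 * `|X w|))%:E)%E); last first.
  apply: (@le_lt_trans _ _ (4%:E * (2 * expR (phi (a * 1)))%:E)%E);
    last by rewrite ltry.
  by rewrite lee_pmul2l//; exact: mgf_le_abs.
under [in leRHS]eq_integral do rewrite mul1r.
rewrite -ge0_integralZl//.
apply: ge0_le_integral => //.
- exact: measurableT_comp.
- exact: emeasurable_funM.
- by move=> w _; rewrite gee0_abs ?lee_fin ?sqr_ge0// sqr_le_expR.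
Qed.

Lemma integrable_mul X Y : P.-integrable setT (fun w => (X w ^+ 2)%:E) ->
  P.-integrable setT (fun w => (Y w ^+ 2)%:E) ->
  P.-integrable setT (EFin \o (fun w => X w * Y w)).
Proof.
move=> iX iY; apply: (le_integrable measurableT _ _ (integrableD measurableT iX
  iY)).
  by apply/measurable_EFinP; exact: measurable_funM.
move=> w _ /=; rewrite lee_fin [leRHS]ger0_norm ?addr_ge0 ?sqr_ge0//.
have x2 : `|X w| ^+ 2 = X w ^+ 2 by rewrite real_normK ?num_real.
have y2 : `|Y w| ^+ 2 = Y w ^+ 2 by rewrite real_normK ?num_real.
by rewrite normrM -x2 -y2; have := sqr_ge0 (`|X w| - `|Y w|); rewrite !expr2; nra.
Qed.

Lemma expectation_RS_sum_sqr f y n (x xi : nat -> R) :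
  (forall s, P.-integrable setT (fun w => (y s w ^+ 2)%:E)) ->
  ('E_P[fun w => (RS_sum f y n x xi w ^+ 2)%R])%E =
  (\sum_(i < n) \sum_(j < n) f (xi i) * f (xi j) *
     rect_increment (covariance_fun y) (x i) (x i.+1) (x j) (x j.+1))%:E.
Proof.
move=> iy; rewrite unlock.
have iyy s t := integrable_mul (iy s) (iy t).
have cov s t : (\int[P]_w (y s w * y t w)%:E)%E = (covariance_fun y s t)%:E.
  rewrite /covariance_fun unlock.
  under [in RHS]eq_integral do rewrite mulrC.
  by rewrite fineK// integrable_fin_num//; exact: iyy.
pose D i w := y (x i.+1) w - y (x i) w.
have DE i j w : D i w * D j w = y (x i.+1) w * y (x j.+1) w - y (x i.+1) w * y
  (x j) w
    - y (x i) w * y (x j.+1) w + y (x i) w * y (x j) w by rewrite /D; ring.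
pose q s t w := y s w * y t w.
have iq1 i j : P.-integrable setT (EFin \o (fun w => q (x i.+1) (x j.+1) w - q
  (x i.+1) (x j) w)).
  exact: (integrableB measurableT (iyy (x i.+1) (x j.+1)) (iyy (x i.+1) (x j))).
have iq2 i j : P.-integrable setT (EFin \o (fun w => q (x i.+1) (x j.+1) w - q
  (x i.+1) (x j) w - q (x i) (x j.+1) w)).
  exact: (integrableB measurableT (iq1 i j) (iyy (x i) (x j.+1))).
have iD i j : P.-integrable setT (fun w => (D i w * D j w)%:E).
  rewrite (_ : (fun w => _) = (EFin \o (fun w => q (x i.+1) (x j.+1) w - q (x
    i.+1) (x j) w
    - q (x i) (x j.+1) w + q (x i) (x j) w))); last by apply/funext => w /=;
      rewrite DE.
  exact: (integrableD measurableT (iq2 i j) (iyy (x i) (x j))).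
have intD i j : (\int[P]_w (D i w * D j w)%:E)%E =
    (rect_increment (covariance_fun y) (x i) (x i.+1) (x j) (x j.+1))%:E.
  under eq_integral do rewrite DE.
  rewrite (integralD_EFin measurableT (iq2 i j) (iyy _ _)).
  rewrite (integralB_EFin measurableT (iq1 i j) (iyy _ _)).
  rewrite (integralB_EFin measurableT (iyy _ _) (iyy _ _)).
  by rewrite /= !cov.
have RSE w : (RS_sum f y n x xi w ^+ 2)%:E =
    (\sum_(i < n) \sum_(j < n) (f (xi i) * f (xi j))%:E * (D i w * D j w)%:E)%E.
  rewrite /RS_sum expr2 mulr_suml -sumEFin; apply: eq_bigr => i _.
  rewrite mulr_sumr -sumEFin; apply: eq_bigr => j _.
  by rewrite -EFinM; congr EFin; rewrite /D; ring.
under eq_integral do rewrite RSE.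
rewrite integral_sum//; last first.
  by move=> i; apply: integrable_sum => // j _; exact: integrableZl.
rewrite -sumEFin; apply: eq_bigr => i _.
rewrite integral_sum//; last by move=> j; exact: integrableZl.
rewrite -sumEFin; apply: eq_bigr => j _.
by rewrite integralZl// intD.
Qed.

End SecondMoments.

(** * Step functions against the total variation *)

Section ChargeVariation.
Context {R : realType}.
Variables (nu : {charge set @planeR R -> \bar R}) (Pos Neg : set (@planeR R)).
Variable nuPN : hahn_decomposition nu Pos Neg.

(** The half-open cells are disjoint, so at most one term survives. The induction carries along that
    the partial sum vanishes to the right of its last cell. *)
Lemma step_fun_le (g : R -> R) al be delta n (x xi : nat -> R) l :
  tagged_partition al be delta n x xi -> (forall z, 0 <= g z) ->
  (forall i z, (i < n)%N -> x i <= z <= x i.+1 -> g (xi i) <= g z) ->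
  \sum_(i < n) g (xi i) * \1_(`]x i, x i.+1]) l <= g l.
Proof.
move=> xP g0 gmin.
suff H k : (k <= n)%N -> \sum_(i < k) g (xi i) * \1_(`]x i, x i.+1]) l <= g l /\
    (x k < l -> \sum_(i < k) g (xi i) * \1_(`]x i, x i.+1]) l = 0).
  by have [] := H n (leqnn n).
elim: k => [_|k IH kn]; first by rewrite big_ord0.
have [IH1 IH2] := IH (ltnW kn).
have xk : x k <= x k.+1 := tagged_partition_mono xP (leqnSn k) kn.
rewrite big_ord_recr/= indicE; have [|lk] := boolP (l \in _).
  rewrite inE/= in_itv/= => /andP[xkl lxk]; split; last by rewrite ltNge lxk.
  by rewrite IH2// add0r mulr1 gmin// (ltW xkl).
rewrite mulr0 addr0; split => // xkl; apply: IH2.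
exact: le_lt_trans xkl.
Qed.

Lemma measurable_mul_plane (g : R -> R) : continuous g ->
  measurable_fun setT (fun p : @planeR R => (g p.1 * g p.2)%:E).
Proof.
move=> cg; apply/measurable_EFinP.
have mg : measurable_fun (setT : set (measurableTypeR R)) g by exact:
  continuous_measurable_fun.
by apply: measurable_funM; apply: measurableT_comp => //.
Qed.

(** On each cell |nu| is at most the variation, and the product of two step functions built on
    minima of g stays below g(p.1) g(p.2). *)
Lemma charge_step_le (g : R -> R) al be delta n (x xi : nat -> R) :
  tagged_partition al be delta n x xi -> (forall z, 0 <= g z) -> continuous g ->
  (forall i z, (i < n)%N -> x i <= z <= x i.+1 -> g (xi i) <= g z) ->
  ((\sum_(i < n) \sum_(j < n) g (xi i) * g (xi j) *
     `|fine (nu (`]x i, x i.+1] `*` `]x j, x j.+1]))|)%:E <=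
  \int[charge_variation nuPN]_p (g p.1 * g p.2)%:E)%E.
Proof.
move=> xP g0 cg gmin.
pose A (i : nat) : set (measurableTypeR R) := [set` `]x i, x i.+1]].
have mA i : measurable (A i) by exact: measurable_itv.
have mAA i j : measurable (A i `*` A j) by exact: measurableX.
pose h (i j : nat) (p : @planeR R) : \bar R :=
  ((g (xi i) * g (xi j))%:E * (\1_(A i `*` A j) p)%:E)%E.
have gg0 i j : (0 <= (g (xi i) * g (xi j))%:E)%E by rewrite lee_fin mulr_ge0.
have mh i j : measurable_fun setT (h i j).
  apply: emeasurable_funM => //; apply/measurable_EFinP; exact: measurable_indic.
have h0 i j p : (0 <= h i j p)%E by rewrite mule_ge0.
apply: (@le_trans _ _ (\int[charge_variation nuPN]_p (\sum_(i < n) \sum_(j < n)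
  h i j p))%E).
  rewrite ge0_integral_sum//; last first.
    by move=> i p _; apply: sume_ge0 => j _.
    by move=> i; exact: emeasurable_sum.
  rewrite -sumEFin; apply: lee_sum => i _.
  rewrite ge0_integral_sum// -sumEFin; apply: lee_sum => j _.
  rewrite ge0_integralZl//; last by apply/measurable_EFinP; exact: measurable_indic.
  rewrite integral_indic// setIT EFinM lee_wpmul2l//.
  have := abse_charge_variation nuPN (mAA i j).
  have fin : nu (A i `*` A j) \is a fin_num by exact: fin_num_measure.
  by rewrite -{1}(fineK fin).
apply: ge0_le_integral => //.
- by move=> p _; do 2 apply: sume_ge0 => ? _.
- by apply: emeasurable_sum => i; exact: emeasurable_sum.
- exact: measurable_mul_plane.
move=> p _.
have -> : (\sum_(i < n) \sum_(j < n) h i j p)%E =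
  ((\sum_(i < n) g (xi i) * \1_(A i) p.1) * (\sum_(j < n) g (xi j) * \1_(A j)
    p.2))%:E.
  rewrite mulr_suml -sumEFin; apply: eq_bigr => i _.
  rewrite mulr_sumr -sumEFin; apply: eq_bigr => j _.
  rewrite /h -EFinM; congr EFin; rewrite !indicE in_setX;
    case: (_ \in _) => /=; last by rewrite !(mulr0, mul0r).
  by rewrite mulr1; ring.
rewrite lee_fin; apply: ler_pM.
- by apply: sumr_ge0 => i _; rewrite mulr_ge0.
- by apply: sumr_ge0 => i _; rewrite mulr_ge0.
- exact: step_fun_le xP g0 gmin.
- exact: step_fun_le xP g0 gmin.
Qed.

End ChargeVariation.

(** * Exponential moments of mean-square integrals *)

Section StochasticIntegral.
Context {d : measure_display} {Omega : measurableType d} {R : realType}.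
Variable P : probability Omega R.
Implicit Types (phi f g : R -> R) (y : R -> {RV P >-> R}) (X Y : {RV P >-> R}).

Lemma cvg_addr_right0 (f : R -> R) x : {for x, continuous f} ->
  f (x + h) @[h --> 0^'+] --> f x.
Proof.
move=> cf; have -> : f x = (f \o (fun h => x + h)) 0 by rewrite /= addr0.
apply: cvg_at_right_filter; apply: continuous_comp => /=.
  by apply: cvgD; [exact: cvg_cst|exact: cvg_id].
by rewrite addr0.
Qed.

Section bimeasure.
Variables (y : R -> {RV P >-> R}) (nu : {charge set @planeR R -> \bar R}).
Variables (Pos Neg : set (@planeR R)) (nuPN : hahn_decomposition nu Pos Neg).
Hypothesis y_sqr : forall s, P.-integrable setT (fun w => (y s w ^+ 2)%:E).
Hypothesis y_nu : LS_bimeasure (covariance_fun y) nu.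

(* The tags are minimum points of [`|f|], so that the limit [h -> 0+] of the
   second moment of the shifted sum is below the double integral, without any
   appeal to uniform continuity. *)
Lemma RS_approx_second_moment f (X : Omega -> R) (B e : R) :
  RS_approx f y X -> continuous f ->
  (\int[charge_variation nuPN]_p (`|f p.1| * `|f p.2|)%:E <= B%:E)%E ->
  0 < e -> exists n x xi,
    (ms_dist2 P (RS_sum f y n x xi) X < e%:E)%E /\
    ('E_P[fun w => (RS_sum f y n x xi w ^+ 2)%R] < (B + e)%:E)%E.
Proof.
move=> fX cf fB e0; have [A fA] := fX e e0.
have AA : A <= `|A| by exact: ler_norm.
have A0 : 0 <= `|A| by exact: normr_ge0.
have [||delta delta0 fd] := fA (- (`|A| + 1)) (`|A| + 1); [lra..|].
have [|n [x [xi0 xP0]]] := @tagged_partition_exists R (- (`|A| + 1)) (`|A| + 1)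
  delta _ delta0.
  lra.
have cnf : continuous (fun z => `|f z|).
  by move=> z; apply: continuous_comp; [exact: cf|exact: norm_continuous].
have /choice[xi xiP] : forall i, exists c, (i < n)%N ->
    x i <= c <= x i.+1 /\ forall z, x i <= z <= x i.+1 -> `|f c| <= `|f z|.
  move=> i; have [ilt|_] := boolP (i < n)%N; last by exists 0.
  have [||c cx cmin] := @EVT_min R (fun z => `|f z|) (x i) (x i.+1).
  - exact: (tagged_partition_mono xP0 (leqnSn i) ilt).
  - exact: continuous_subspaceT.
  by exists c => _; split => [|z zx]; [move: cx|apply: cmin]; rewrite in_itv.
have xP : tagged_partition (- (`|A| + 1)) (`|A| + 1) delta n x xi.
  by have [? ? _ ?] := xP0; split => // i /xiP[].
pose V h := \sum_(i < n) \sum_(j < n) f (xi i + h) * f (xi j + h) *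
  rect_increment (covariance_fun y) (x i + h) (x i.+1 + h) (x j + h) (x j.+1 + h).
pose V0 := \sum_(i < n) \sum_(j < n) f (xi i) * f (xi j) *
  fine (nu (`]x i, x i.+1] `*` `]x j, x j.+1])).
have VV0 : V h @[h --> 0^'+] --> V0.
  apply: cvg_big => [|i _]; first exact: add_continuous.
  apply: cvg_big => [|j _]; first exact: add_continuous.
  apply: cvgM; last by apply: y_nu;
    exact: (tagged_partition_mono xP (leqnSn _) (ltn_ord _)).
  by apply: cvgM; apply: cvg_addr_right0; exact: cf.
have V0B : V0 <= B.
  rewrite -lee_fin; apply: le_trans fB.
  apply: le_trans (charge_step_le nuPN xP _ cnf _) => //.
    rewrite lee_fin /V0; apply: ler_sum => i _; apply: ler_sum => j _.
    by rewrite (le_trans (ler_norm _))// !normrM.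
  by move=> i z ilt zx; have [_] := xiP i ilt; apply.
(* Partition and tags are already fixed, so a single small h suffices for this finite sum, while
   [fd] still controls the distance to X. *)
have [h [h0 h1 Vh]] : exists h, [/\ 0 <= h, h <= 1 & V h < V0 + e].
  near (0 : R)^'+ => h; exists h; split.
  - by near: h; exact: nbhs_right_ge.
  - by near: h; apply: nbhs_right_le.
  - near: h; apply: (cvgr_lt _ VV0); lra.
exists n, (fun i => x i + h), (fun i => xi i + h); split.
  exact: (fd h n x xi).
rewrite expectation_RS_sum_sqr// lte_fin.
apply: (lt_le_trans Vh); lra.
Unshelve. all: by end_near. Qed.

End bimeasure.

Section linear_combination.
Variables (y : R -> {RV P >-> R}) (f : R -> R) (n : nat) (x xi : nat -> R).

Definition RS_mfun : {RV P >-> R} :=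
  \sum_(i < n) scale_mfun (f (xi i)) (y (x i.+1) - y (x i)).

Lemma RS_mfunE w : RS_mfun w = RS_sum f y n x xi w.
Proof.
rewrite /RS_mfun mfun_sum /RS_sum; apply: eq_bigr => i _ /=.
by rewrite mulrC.
Qed.

(** Strictness concerns combinations of values of y, not of increments. The sum is unfolded into n
    right endpoints followed by n left endpoints with opposite coefficients; later coefficients are
    0, so the series is stationary. *)
Lemma RS_mfun_tau phi C : strictly_sub_gaussian_process phi y C ->
  (tau phi RS_mfun <= (C * Num.sqrt (fine 'E_P[fun w => (RS_mfun w ^+ 2)%R]))%:E)%E.
Proof.
move=> [_]; pose zeta i := y (if (i < n)%N then x i.+1 else x (i - n)%N).
pose l i := if (i < n)%N then f (xi i) else
  if (i < n + n)%N then - f (xi (i - n)%N) else 0.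
move=> /(_ zeta l RS_mfun); apply; first by move=> i;
  exists (if (i < n)%N then x i.+1 else x (i - n)%N).
apply: cvg_near_cst; near=> m.
have /subnKC <- : (n + n <= m)%N by near: m; exact: nbhs_infty_ge.
rewrite /ms_dist2 -[RHS](expectation_cst P 0); congr ('E_P[_])%E;
  apply/funext => w /=.
rewrite RS_mfunE /RS_sum big_split_ord/= [X in (_ + X - _)]big1; last first.
  by move=> i _; rewrite /l !ltnNge -addnA !leq_addr/= addnA leq_addr mul0r.
rewrite addr0 big_split_ord/= -big_split/=.
apply/eqP; rewrite sqrf_eq0 subr_eq0; apply/eqP/eq_bigr => i _.
rewrite /l /zeta ltn_ord ltnNge leq_addr/= ltn_add2l ltn_ord addKn; ring.
Unshelve. all: by end_near. Qed.

End linear_combination.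

(** The sign of C is not given, and enlarging the second moment to its bound needs a non-negative
    factor; hence [Num.max C 0]. *)
Lemma RS_approx_mgf_le phi y (C : R) (nu : {charge set @planeR R -> \bar R})
    (Pos Neg : set (@planeR R)) (nuPN : hahn_decomposition nu Pos Neg) f X (B : R) :
  Orlicz_Nfunction phi -> strictly_sub_gaussian_process phi y C ->
  LS_bimeasure (covariance_fun y) nu ->
  RS_approx f y X -> continuous f -> 0 <= B ->
  (\int[charge_variation nuPN]_p (`|f p.1| * `|f p.2|)%:E <= (B ^+ 2)%:E)%E ->
  mgf_le P phi X (Num.max C 0 * B).
Proof.
move=> phiN yC y_nu fX cf B0 fB.
have y_sqr s : P.-integrable setT (fun w => (y s w ^+ 2)%:E).
  by apply: (sub_gaussian_integrable_sqr phiN); apply: yC.1; exists s.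
(* The summable rate required by [mgf_le_lim], used also as the excess of the second moments over
   B^2. *)
pose en n : R := 1 / (2 ^ n.+1)%:R.
have en0 n : 0 < en n by rewrite divr_gt0// ltr0n expn_gt0.
have /choice[N NP] n : exists t : nat * (nat -> R) * (nat -> R),
    (ms_dist2 P (RS_sum f y t.1.1 t.1.2 t.2) X < (en n)%:E)%E /\
    ('E_P[fun w => (RS_sum f y t.1.1 t.1.2 t.2 w ^+ 2)%R] < (B ^+ 2 + en n)%:E)%E.
  have [k [x [xi [H1 H2]]]] := RS_approx_second_moment y_sqr y_nu fX cf fB (en0 n).
  by exists (k, x, xi).
pose S n := RS_mfun y f (N n).1.1 (N n).1.2 (N n).2.
have SE n : S n = RS_sum f y (N n).1.1 (N n).1.2 (N n).2 :> (Omega -> R).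
  by apply/funext => w; exact: RS_mfunE.
have C0 : 0 <= Num.max C 0 by rewrite le_max lexx orbT.
apply: (mgf_le_lim (S := S) (en :=
  fun n => Num.max C 0 * Num.sqrt (B ^+ 2 + en n))) => //.
- by move=> n; rewrite SE; apply/ltW; have [] := NP n.
- apply: cvgMr; rewrite -[X in _ --> X](ger0_norm B0) -sqrtr_sqr.
  apply: continuous_cvg; first exact: sqrt_continuous.
  rewrite -[X in _ --> X]addr0; apply: cvgD; first exact: cvg_cst.
  rewrite (_ : en = (fun n => (1 / 2) * (1 / 2) ^+ n)); last first.
    by apply/funext => n; rewrite /en natrX !div1r exprS invfM exprVn.
  rewrite -(mulr0 (1 / 2)); apply: cvgMr; apply: cvg_expr.
  by rewrite ger0_norm; lra.
- move=> n; have tauS := RS_mfun_tau f (N n).1.1 (N n).1.2 (N n).2 yC.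
  have e0 := le_trans (tau_ge0 phi _) tauS; rewrite lee_fin in e0.
  apply: mgf_leW (tau_le_mgf_le phiN tauS) => //.
  apply: (@le_trans _ _ (Num.max C 0 * Num.sqrt (fine 'E_P[fun w => (S n w ^+
    2)%R]%E))).
    by rewrite ler_wpM2r ?sqrtr_ge0// le_max lexx.
  apply: ler_wpM2l => //; apply: ler_wsqrtr.
  have := (NP n).2; rewrite SE; case: ('E_P[_])%E => [z| |]//=.
    by rewrite lte_fin => /ltW.
  by move=> _; rewrite addr_ge0// ?sqr_ge0// ltW.
Qed.

End StochasticIntegral.

(** * Lower sums on a geometric partition *)

Section LowerSums.
Context {R : realType}.
Notation mu := (@lebesgue_measure R).

Lemma nonincreasing_in_measurable (D : set R) (f : R -> R) : is_interval D ->
  (forall s t, D s -> D t -> s <= t -> f t <= f s) -> measurable_fun D f.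
Proof.
move=> iD f_ni mD.
apply: (measurability (@RGenCInfty.G R)) => [|/= _ [_] [r] -> <-|//].
  exact: RGenCInfty.measurableE.
apply: is_interval_measurable => s t /=.
rewrite !in_itv/= !andbT => -[Ds fs] [Dt ft] z /andP[sz zt].
have Dz : D z by apply: (iD s t) => //; rewrite sz zt.
by split=> //=; rewrite in_itv/= andbT; apply: (le_trans ft); exact: f_ni.
Qed.

(** The cell [th^(k+1) T, th^k T[ has length (1 - th) th^k T, and G is at least G(th^k T) on it; on
    the rest ]0, th^n T[ only g1 is used. The induction peels off the rightmost cell and replaces T
    by th T. *)
Lemma geo_lower_sum (G : R -> R) (g1 th : R) n (T : R) : 0 < th -> th < 1 ->
  0 < T ->
  (forall s t, 0 < s -> s <= t -> G t <= G s) -> 0 <= g1 ->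
  (forall s, 0 < s -> g1 <= G s) ->
  (((geo_mean th n (fun k => G (th ^+ k * T)) + th ^+ n * g1) * T)%:E <=
   \int[mu]_(s in `]0%R, T[) (G s)%:E)%E.
Proof.
move=> th0 th1 + G_ni g1_ge0 Gg1.
have mG (T' : R) : measurable_fun `]0, T'[ (fun s => (G s)%:E).
  apply/measurable_EFinP; apply: nonincreasing_in_measurable.
    exact: interval_is_interval.
  by move=> s t /=; rewrite !in_itv/= => /andP[s0 _] _; exact: G_ni.
have G0 s : 0 < s -> 0 <= G s by move=> /Gg1; exact: le_trans.
elim: n T => [|n IH] T T0.
  rewrite geo_mean0 add0r expr0 mul1r.
  apply: (@le_trans _ _ (\int[mu]_(s in `]0%R, T[) g1%:E)%E).
    by rewrite integral_cst//= lebesgue_measure_itv/= lte_fin T0 sube0 EFinM.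
  apply: ge0_le_integral => //.
  - exact: mG.
  - by move=> s /=; rewrite in_itv/= => /andP[s0 _]; rewrite lee_fin Gg1.
have thT : th * T < T by rewrite gtr_pMl.
have thT0 : 0 < th * T by rewrite mulr_gt0.
have TE : `]0, T[%classic = `]0, th * T[%classic `|` `[th * T, T[%classic.
  by rewrite -itv_bndbnd_setU// bnd_simp ltW.
rewrite TE ge0_integral_setU//=; last 3 first.
- by rewrite -TE; exact: mG.
- by move=> s [|]/=; rewrite in_itv/= => /andP[s0 _]; rewrite lee_fin G0//;
  exact: lt_le_trans s0.
- apply/disj_setPS => s [/=]; rewrite !in_itv/= => /andP[_ s1] /andP[s2 _].
  by have := lt_le_trans s1 s2; rewrite ltxx.
have -> : ((geo_mean th n.+1 (fun k => G (th ^+ k * T)) + th ^+ n.+1 * g1) * T)%:E =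
  (((geo_mean th n (fun k => G (th ^+ k * (th * T))) + th ^+ n * g1) * (th *
    T))%:E +
   (G T * (T - th * T))%:E)%E.
  rewrite geo_meanS/= -EFinD; congr EFin.
  rewrite (_ : geo_mean th n ((fun k => G (th ^+ k * T)) \o succn) =
    geo_mean th n (fun k => G (th ^+ k * (th * T)))).
    by rewrite expr0 mul1r exprS; ring.
  by apply: eq_bigr => i _ /=; rewrite exprS mulrCA mulrA.
apply: leeD; first exact: IH.
apply: (@le_trans _ _ (\int[mu]_(s in `[(th * T)%R, T[) (G T)%:E)%E).
  by rewrite integral_cst//= lebesgue_measure_itv/= lte_fin thT EFinM.
apply: ge0_le_integral => //.
- by move=> s _; rewrite lee_fin G0.
- apply/measurable_EFinP; apply: nonincreasing_in_measurable.
    exact: interval_is_interval.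
  move=> s t /=; rewrite !in_itv/= => /andP[s0 _] _; apply: G_ni.
  exact: lt_le_trans s0.
- move=> s /=; rewrite in_itv/= => /andP[s0 /ltW sT]; rewrite lee_fin G_ni//.
  exact: lt_le_trans s0.
Qed.

End LowerSums.

(** * Chaining with geometric weights *)

Section Chaining.
Context {d : measure_display} {Omega : measurableType d} {R : realType}.
Variable P : probability Omega R.
Variables (T : choiceType) (X : T -> {RV P >-> R}) (phi : R -> R).
Hypothesis phiN : Orlicz_Nfunction phi.

Lemma measurable_has_gt (s : seq T) (u : R) :
  measurable [set w | has (fun t => u < `|X t w|) s].
Proof.
elim: s => [|t s IH].
  by rewrite (_ : [set _ | _] = set0)//; apply/seteqP; split.
rewrite (_ : [set _ | _] = [set w | u < `|X t w|] `|` [set w | has (fun t => u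
  < `|X t w|) s]).
  by apply: measurableU => //; exact: measurable_norm_gt.
by apply/seteqP; split => w /= /orP.
Qed.

Variables (V : nat -> seq T) (pr : nat -> T -> T) (N : nat -> R) (e th : R).
Hypotheses (e_gt0 : 0 < e) (th_gt0 : 0 < th) (th_lt1 : th < 1).
Hypothesis N_ge1 : forall k, 1 <= N k.
Hypothesis V_size : forall k, (size (V k))%:R <= N k.
Hypothesis pr_V : forall k t, t \in V k.+1 -> pr k t \in V k.

(** Level 0 has no predecessor: its link is X itself, which is why the scale th^k e of the links
    starts at e. *)
Let Y (k : nat) (t : T) : {RV P >-> R} :=
  if k is k'.+1 then (X t - X (pr k' t) : {mfun _ >-> _}) else X t.

Hypothesis Y_mgf : forall k t, t \in V k -> mgf_le P phi (Y k t) (th ^+ k * e).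

Let chain n t : t \in V n -> exists s : nat -> T,
  (forall k, (k <= n)%N -> s k \in V k) /\
  forall w, `|X t w| <= \sum_(k < n.+1) `|Y k (s k) w|.
Proof.
elim: n t => [|n IH] t tV.
  exists (fun=> t); split => [k|w]; first by rewrite leqn0 => /eqP ->.
  by rewrite big_ord_recl big_ord0 addr0.
have [s [sV sX]] := IH _ (pr_V tV).
exists (fun k => if k == n.+1 then t else s k); split => [k|w].
  rewrite leq_eqVlt; case: eqP => [-> //|_ /= kn]; exact: sV.
rewrite big_ord_recr/= eqxx.
under eq_bigr => i _ do rewrite ifN ?ltn_eqF//.
rewrite (le_trans _ (lerD (sX w) (lexx _)))//.
rewrite (_ : X t w = X (pr n t) w + (X t w - X (pr n t) w));
  last by rewrite addrC subrK.
by rewrite (le_trans (ler_normD _ _)).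
Qed.

(* Convexity of [expR] stands in for Hoelder's inequality: with the weights
   [p k = (1 - th) * th ^+ k], the exponential of [lam * sum_k |Y k|] is at most
   a constant times [sum_k p k * exp (lam / p k * |Y k|) / B k + th ^+ n.+1], where
   [B k] bounds the expectation of the k-th term summed over the net. *)
Lemma chaining_tail n u l : 0 <= l ->
  (P [set w | has (fun t => (u < `|X t w|)%R) (V n)] <=
   (2 * expR (phi l - l * (u * (1 - th) / e)) *
    expR (geo_mean th n.+1 (fun k => ln (N k))))%:E)%E.
Proof.
move=> l0; set A := [set w | _].
have mA : measurable A := measurable_has_gt (V n) u.
have th1 : 0 < 1 - th by rewrite subr_gt0.
(* Chosen so that th^k e * (lam / p k) = l for every k: all links then share the exponent phi l. *)
pose lam := l * (1 - th) / e.
have lam0 : 0 <= lam by rewrite divr_ge0 ?mulr_ge0// ltW.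
pose p k := (1 - th) * th ^+ k.
have p0 k : 0 < p k by rewrite mulr_gt0 ?exprn_gt0.
(* The 2 comes from the absolute value, N k from summing over all points of the net. *)
pose B k := 2 * N k * expR (phi l).
have N0 k : 0 < N k by rewrite (lt_le_trans _ (N_ge1 k)).
have B0 k : 0 < B k by rewrite !mulr_gt0 ?expR_gt0.
pose E k s w := expR (lam / p k * `|Y k s w|).
(* The summand th^(n+1) completes the weights p k to total mass 1, so that the integral of G is at
   most 1. *)
pose G w := (\sum_(k < n.+1) (p k / B k)%:E * (\sum_(s <- V k) (E k s w)%:E) +
  (th ^+ n.+1)%:E)%E.
have mE k s : measurable_fun setT (fun w => (E k s w)%:E).
  apply/measurable_EFinP; apply: measurableT_comp => //.
  by apply: measurable_funM => //; exact: measurableT_comp.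
have E0 k s w : (0 <= (E k s w)%:E)%E by rewrite lee_fin expR_ge0.
have mS k : measurable_fun setT (fun w => \sum_(s <- V k) (E k s w)%:E)%E.
  by apply: emeasurable_sum => s; exact: mE.
have S0 k w : (0 <= \sum_(s <- V k) (E k s w)%:E)%E by exact: sume_ge0.
have pB0 k : (0 <= (p k / B k)%:E)%E by rewrite lee_fin divr_ge0 ?ltW.
have mpS k : measurable_fun setT (fun w => (p k / B k)%:E * (\sum_(s <- V k) (E
  k s w)%:E))%E.
  exact: emeasurable_funM.
have pS0 k w : (0 <= (p k / B k)%:E * (\sum_(s <- V k) (E k s w)%:E))%E by
  rewrite mule_ge0.
have mG : measurable_fun setT G.
  by apply: emeasurable_funD => //; exact: emeasurable_sum.
pose L := geo_mean th n.+1 (fun k => ln (B k)).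
have AG w : A w -> ((expR (lam * u - L))%:E <= G w)%E.
  move=> /hasP[t tV /ltW ut].
  have [s [sV sX]] := chain tV.
  have := geo_mean_expR n.+1 (fun k => lam / p k * `|Y k (s k) w| - ln (B k))
    (ltW th_gt0) (ltW th_lt1).
  rewrite geo_meanD (_ : geo_mean th n.+1 (fun k => - ln (B k)) = - L); last first.
    by rewrite /L /geo_mean -sumrN; apply: eq_bigr => i _; rewrite mulrN.
  rewrite (_ : geo_mean th n.+1 (fun k => lam / p k * `|Y k (s k) w|) =
     lam * \sum_(k < n.+1) `|Y k (s k) w|); last first.
    rewrite /geo_mean mulr_sumr; apply: eq_bigr => i _.
    have := p0 i; rewrite /p => pi; field; rewrite !gt_eqF ?exprn_gt0//=.
  move=> H; apply: (@le_trans _ _ (expR (lam * \sum_(k < n.+1) `|Y k (s k) w| -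
    L))%:E).
    by rewrite lee_fin ler_expR lerD2r ler_wpM2l// (le_trans ut).
  apply: (@le_trans _ _ (geo_mean th n.+1 (expR \o (fun k => lam / p k * `|Y k
    (s k) w| - ln (B k))) + th ^+ n.+1)%:E).
    by rewrite lee_fin.
  rewrite EFinD leeD2r// /geo_mean -sumEFin; apply: lee_sum => k _.
  rewrite /= expRB lnK ?posrE// (_ : _ * (_ / _) = (p k / B k) * E k (s k) w);
    last first.
    by rewrite /E mulrA mulrAC.
  rewrite EFinM; apply: lee_wpmul2l => //.
  (* The chain depends on w through t; bounding its k-th term by the sum over V k removes this
     dependence. *)
  have := sV k (ltn_ord k); elim: (V k) => //= a q IH.
  rewrite inE big_cons => /predU1P[<-|/IH Hq]; first by rewrite leeDl// sume_ge0.
  by rewrite (le_trans Hq)// leeDr.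
have intG : (\int[P]_w G w <= 1)%E.
  rewrite ge0_integralD//=; last 3 first.
  - by move=> w _; exact: sume_ge0.
  - exact: emeasurable_sum.
  - by move=> w _; rewrite lee_fin exprn_ge0// ltW.
  rewrite integral_cst//= probability_setT mule1 ge0_integral_sum//.
  apply: (@le_trans _ _ (\sum_(k < n.+1) (p k)%:E + (th ^+ n.+1)%:E)%E); last first.
    rewrite sumEFin -EFinD lee_fin.
    have := geo_mean_cst th n.+1 1; rewrite /geo_mean.
    under eq_bigr do rewrite mulr1.
    by move=> ->; rewrite mulr1 subrK.
  rewrite leeD2r//; apply: lee_sum => k _.
  rewrite ge0_integralZl// ge0_integral_sum//.
  apply: (@le_trans _ _ ((p k / B k)%:E * (B k)%:E)%E);
    last by rewrite -EFinM divfK// gt_eqF.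
  apply: lee_wpmul2l => //.
  apply: (@le_trans _ _ (\sum_(s <- V k) (2 * expR (phi l))%:E)%E).
    rewrite big_seq [leRHS]big_seq; apply: lee_sum => s sV.
    have := mgf_le_abs (lam / p k) phiN (Y_mgf sV).
    rewrite (_ : th ^+ k * e * (lam / p k) = l)//.
    by rewrite /lam /p; field; rewrite !gt_eqF ?exprn_gt0.
  rewrite sumEFin big_const_seq count_predT iter_addr addr0 lee_fin
    -[leLHS]mulr_natr /B.
  by rewrite mulrAC ler_wpM2r ?expR_ge0// ler_pM2l.
have PA : (P A <= (expR (L - lam * u))%:E)%E.
  rewrite -(@lee_pmul2l _ (expR (lam * u - L))%:E)//;
    last by rewrite lte_fin expR_gt0.
  rewrite -EFinM -expRD (_ : lam * u - L + (L - lam * u) = 0) ?expR0; last by ring.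
  apply: le_trans intG.
  rewrite -[A in P A]setIT -integral_indic// -ge0_integralZl//;
    last exact/measurable_EFinP.
  apply: ge0_le_integral => //.
  - by apply: emeasurable_funM => //; exact/measurable_EFinP.
  - move=> w _; rewrite indicE; have [/set_mem wA|_] := boolP (w \in A).
      by rewrite mule1; exact: AG.
    by rewrite mule0 /G adde_ge0// ?sume_ge0// lee_fin exprn_ge0// ltW.
apply: (le_trans PA); rewrite lee_fin.
(* The constant ln 2 + phi l has weight 1 - th^(n+1), and since it is non-negative the weight may be
   raised to 1. *)
have LE : L <= ln 2 + phi l + geo_mean th n.+1 (fun k => ln (N k)).
  rewrite /L (_ : (fun k => ln (B k)) = (fun k => (ln 2 + phi l) + ln (N k)));
    last first.
    apply/funext => k; rewrite /B !lnM ?posrE ?mulr_gt0 ?expR_gt0// expRK; ring.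
  rewrite geo_meanD lerD2r geo_mean_cst ler_piMl//.
    by apply: addr_ge0; [rewrite ln_ge0// ler1n|exact: Nfunction_ge0].
  by rewrite lerBlDr lerDl exprn_ge0// ltW.
rewrite -[2](@lnK R) ?posrE// -!expRD ler_expR.
rewrite (_ : lam * u = l * (u * (1 - th) / e)); last by rewrite /lam; field;
  rewrite gt_eqF.
by move: LE; lra.
Qed.

End Chaining.

(** * From exponential bounds to the tail of the supremum *)

Section Tails.
Context {d : measure_display} {Omega : measurableType d} {R : realType}.
Variable P : probability Omega R.

(** No optimal l has to exist: if P A > 0, taking logarithms bounds every l x - phi l by the same
    number, hence also their supremum. *)
Lemma Young_Fenchel_tail (phi : R -> R) (A : set Omega) (x z : R) :
  Orlicz_Nfunction phi -> measurable A -> 0 <= x -> 0 < z ->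
  (forall l, 0 <= l -> (P A <= (2 * expR (phi l - l * x) * z)%:E)%E) ->
  (P A <= (2 * (expR (- Young_Fenchel phi x) * z))%:E)%E.
Proof.
move=> phiN mA x0 z0; rewrite -(fineK (fin_num_measure P A mA)).
set p := fine _ => PA; rewrite lee_fin.
have [p0|p0] := leP p 0; first by rewrite (le_trans p0)// !mulr_ge0 ?expR_ge0// ltW.
have z20 : 0 < 2 * z by rewrite mulr_gt0.
have Fx : Young_Fenchel phi x <= - ln (p / (2 * z)).
  apply: Young_Fenchel_ge => // l l0; rewrite lerNr.
  rewrite -ler_expR lnK ?posrE ?divr_gt0// ler_pdivrMr//.
  have := PA l l0; rewrite lee_fin => /le_trans; apply.
  by rewrite mulrAC mulrC (_ : - (x * l - phi l) = phi l - l * x)//; ring.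
rewrite mulrCA -ler_pdivrMr// -[leLHS](@lnK R) ?posrE ?divr_gt0//.
by rewrite ler_expR lerNr.
Qed.

(** At parameter 0 the exponential moments of |X| stay below 2 for all l, and letting l grow kills
    each tail at v > 0; a countable union reaches u = 0. *)
Lemma mgf_le0_null (phi : R -> R) (X : {RV P >-> R}) u : Orlicz_Nfunction phi ->
  mgf_le P phi X 0 -> 0 <= u -> P [set w | u < `|X w|] = 0%E.
Proof.
move=> phiN X0 u0.
have H v : 0 < v -> P [set w | v < `|X w|] = 0%E.
  move=> v0; apply/eqP; rewrite eq_le measure_ge0 andbT.
  have mA := measurable_norm_gt X v.
  rewrite -(fineK (fin_num_measure P _ mA)) lee_fin leNgt; apply/negP => p0.
  set p := fine _ in p0.
  have pl l : 0 <= l -> p <= 2 * expR (- (l * v)).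
    move=> l0; rewrite -lee_fin /p fineK ?fin_num_measure//.
    apply: markov_expR_abs => //; apply: (le_trans (mgf_le_abs l phiN X0)).
    by have [_ [phi0 _ _ _]] := phiN; rewrite mul0r phi0 expR0 mulr1.
  (* With l = 2 / (p v) the bound becomes p exp(2 / p) <= 2, whereas p exp(2 / p) >= p + 2. *)
  have l0 : 0 <= 2 / p / v by rewrite !divr_ge0// ltW.
  have := pl _ l0; rewrite divfK ?gt_eqF// expRN.
  rewrite ler_pdivlMr ?expR_gt0// leNgt => /negP; apply.
  have /(ler_wpM2l (ltW p0)) := expR_ge1Dx (2 / p).
  by rewrite mulrDr mulr1 mulrCA mulfV ?gt_eqF// mulr1 => /(lt_le_trans _);
    apply; lra.
apply/negligibleP; first exact: measurable_norm_gt.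
apply: (@negligibleS _ _ _ P (\bigcup_n [set w | n.+1%:R^-1 < `|X w|])) => [w
  /= uX|].
  have /ltr_add_invr[n] : 0 < `|X w| by exact: le_lt_trans uX.
  by rewrite add0r => nX; exists n.
apply: negligible_bigcup => n; apply/negligibleP; first exact: measurable_norm_gt.
by apply: H; rewrite invr_gt0.
Qed.

(** On a continuous path, |U p| > u persists near p, and every sufficiently fine net has a point
    there. The event thus lies, up to a null set, in the increasing union of the [L n]. *)
Lemma sup_tail (a b c e : R) (U : R -> R -> {RV P >-> R}) (W : nat ->
  seq (R * R)) (u B : R) :
  {ae P, forall w, {within `[a, b] `*` `[c, e],
     continuous (fun p : R * R => U p.1 p.2 w)}} ->
  (forall n z, z \in W n -> (`[a, b] `*` `[c, e]) z) ->
  (forall delta, 0 < delta -> exists N, forall n, (N <= n)%N ->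
     forall p, (`[a, b] `*` `[c, e]) p ->
       exists2 z, z \in W n & Num.max `|p.1 - z.1| `|p.2 - z.2| <= delta) ->
  (forall n, (P [set w | has (fun t => (u < `|U t.1 t.2 w|)%R) (W n)] <= B%:E)%E) ->
  (mu_ext P [set w | (u%:E <
     ereal_sup [set `|U p.1 p.2 w|%:E | p in `[a, b] `*` `[c, e]])%E] <= B%:E)%E.
Proof.
move=> [N0 [mN0 PN0 N0U]] Wrect Wnet PW.
pose A n := [set w | has (fun t => u < `|U t.1 t.2 w|) (W n)].
have mA n : measurable (A n) := measurable_has_gt (fun t : R * R => U t.1 t.2)
  (W n) u.
pose L n := \bigcap_(k in [set k | (n <= k)%N]) A k.
have mL n : measurable (L n) by exact: bigcap_measurableType.
have mLU : measurable (\bigcup_n L n) by exact: bigcup_measurable.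
apply: (@le_trans _ _ (mu_ext P (N0 `|` \bigcup_n L n))).
  apply: le_mu_ext => w /=.
  have [cw|] := pselect ({within `[a, b] `*` `[c, e],
    continuous (fun p : R * R => U p.1 p.2 w)}); last first.
    by move=> nc _; left; exact: N0U.
  move=> /ereal_sup_gt[_ [p pr <-]]; rewrite lte_fin => up; right.
  have := (subspace_continuousP _ _).1 cw p pr.
  move=> /cvg_norm /cvgr_gt /(_ _ up) /nbhs_ballP[delta /= delta0 pd].
  have d20 : 0 < delta / 2 by rewrite divr_gt0.
  have [M WM] := Wnet _ d20.
  exists M => // n /= Mn; have [z zW pz] := WM n Mn p pr.
  apply/hasP; exists z => //; apply: pd; last exact: Wrect zW.
  by move: pz; rewrite ge_max => /andP[p1 p2]; split; rewrite /ball/=;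
    [apply: (le_lt_trans p1)|apply: (le_lt_trans p2)]; lra.
rewrite measurable_mu_extE; last exact: measurableU.
apply: (@le_trans _ _ (P N0 + P (\bigcup_n L n))%E); first exact: measureU2.
rewrite PN0 add0e.
have ndL : {homo L : n m / (n <= m)%N >-> (n <= m)%O}.
  move=> n m nm; apply/subsetPset => w Lw k /= mk; apply: Lw => /=.
  exact: leq_trans mk.
have := nondecreasing_cvg_mu (mu := P) mL mLU ndL.
move=> /cvg_lim <-//; apply: lime_le.
  by apply: ereal_nondecreasing_is_cvgn => n m nm; apply: le_measure;
    rewrite ?inE//; exact/subsetPset/ndL.
apply: nearW => n; apply: le_trans (PW n).
apply: le_measure; rewrite ?inE//; first exact: mA.
by move=> w; apply => /=.
Qed.

End Tails.

(** * Nets of radius [sigma^(-1)(v)] and their size *)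

Section Covering.
Context {R : realType}.

(* [1 / sigma^(-1)(v)], for [K = 2 * Cy * Cz] *)
Definition inv_radius (Z : R -> R) (u0 K v : R) : R :=
  inv_on `[0, +oo[ Z (K / v) - u0.

Variables (phi Z : R -> R) (u0 a b c d K : R).
Hypotheses (Z_adm : admissible phi Z u0) (le_ab : a <= b) (le_cd : c <= d).
Hypothesis K_gt0 : 0 < K.

Let vk := Num.max (b - a) (d - c).
Hypothesis vk_gt0 : 0 < vk.

Let g0 := K / Z (1 / vk + u0).
Local Notation q := (inv_radius Z u0 K).

(* Bounds the number of points of a [sigma^(-1)(v)]-net; from [v = gamma0] on,
   a single point is one. *)
Definition covering_bound v : R :=
  if v < g0 then ((b - a) / 2 * q v + 1) * ((d - c) / 2 * q v + 1) else 1.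

Let u0_ge0 : 0 <= u0 := admissible_u0 Z_adm.

Let ab2 : 0 <= (b - a) / 2. Proof. by rewrite divr_ge0 ?subr_ge0. Qed.
Let cd2 : 0 <= (d - c) / 2. Proof. by rewrite divr_ge0 ?subr_ge0. Qed.

Let Zh_gt0 h : 0 < h -> 0 < Z (1 / h + u0).
Proof.
by move=> h0; apply: (admissible_gt0 Z_adm); rewrite ltr_wpDr// divr_gt0.
Qed.

Lemma covering_scale_gt0 : 0 < g0.
Proof. by rewrite divr_gt0// Zh_gt0. Qed.

(** Below [g0] the value K / v exceeds Z(1 / vk + u0), hence is attained by Z, and the default value
    of [inv_on] does not intervene. *)
Lemma inv_radiusP v : 0 < v -> v < g0 -> 1 / vk < q v /\ Z (q v + u0) = K / v.
Proof.
move=> v0; rewrite ltr_pdivlMr ?Zh_gt0// mulrC -ltr_pdivlMr// => ZK.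
have k0 : 0 <= 1 / vk + u0 by rewrite addr_ge0// divr_ge0// ltW.
have [w kw Zw] := admissible_surj Z_adm k0 (ltW ZK).
have w0 : 0 <= w by exact: le_trans kw.
rewrite /inv_radius -Zw (admissible_inv_onK Z_adm)// subrK; split => //.
rewrite ltrBrDr lt_neqAle kw andbT; apply: contraTneq ZK => ->.
by rewrite Zw ltxx.
Qed.

Let q_gt0 v : 0 < v -> v < g0 -> 0 < q v.
Proof.
by move=> v0 /(inv_radiusP v0)[+ _]; apply: lt_trans; rewrite divr_gt0.
Qed.

Lemma inv_radius_le v w : 0 < v -> v < g0 -> 0 < w -> K / v <= Z (w + u0) ->
  q v <= w.
Proof.
move=> v0 vg w0; have [_ <-] := inv_radiusP v0 vg.
rewrite leNgt => H; rewrite leNgt; apply: contra H => wq.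
by apply: (admissible_incr Z_adm); rewrite ?ltrD2r// addr_ge0// ltW.
Qed.

Lemma inv_radius_ge v w : 0 < v -> v < g0 -> Z (w + u0) <= K / v -> w <= q v.
Proof.
move=> v0 vg; have [_ <-] := inv_radiusP v0 vg.
rewrite leNgt => H; rewrite leNgt; apply: contra H => qw.
apply: (admissible_incr Z_adm); rewrite ?ltrD2r// addr_ge0// ltW//.
exact: q_gt0.
Qed.

Lemma inv_radius_ni v w : 0 < v -> v <= w -> w < g0 -> q w <= q v.
Proof.
move=> v0 vw wg; have w0 : 0 < w by exact: lt_le_trans vw.
have vg := le_lt_trans vw wg; apply: inv_radius_le => //; first exact: q_gt0.
by have [_ ->] := inv_radiusP v0 vg; rewrite ler_pM2l// lef_pV2.
Qed.

Lemma inv_radius_small delta : 0 < delta -> exists2 w, 0 < w &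
  forall v, 0 < v -> v <= w -> v < g0 /\ 1 / q v <= delta.
Proof.
move=> delta0; have g00 := covering_scale_gt0.
exists (Num.min (g0 / 2) (K / Z (1 / delta + u0))).
  by rewrite lt_min !divr_gt0// Zh_gt0.
move=> v v0; rewrite le_min => /andP[v1 v2].
have vg : v < g0 by lra.
split => //; rewrite ler_pdivrMr ?q_gt0// mulrC -ler_pdivrMr//.
apply: inv_radius_ge => //; rewrite ler_pdivlMr// mulrC -ler_pdivlMr//.
exact: Zh_gt0.
Qed.

Lemma covering_bound_ge1 v : 0 < v -> 1 <= covering_bound v.
Proof.
move=> v0; rewrite /covering_bound; case: ifPn => // vg.
have q0 := ltW (q_gt0 v0 vg).
by rewrite mulr_ege1// lerDr mulr_ge0.
Qed.

Lemma covering_bound_ni v w : 0 < v -> v <= w ->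
  covering_bound w <= covering_bound v.
Proof.
move=> v0 vw; rewrite {1}/covering_bound; case: ifPn => [wg|_];
  last exact: covering_bound_ge1.
have qq := inv_radius_ni v0 vw wg.
have qw : 0 <= q w by apply/ltW/q_gt0 => //; exact: lt_le_trans vw.
have vg := le_lt_trans vw wg; rewrite /covering_bound vg.
have v1 := mulr_ge0 ab2 qw; have v2 := mulr_ge0 cd2 qw.
by apply: ler_pM; rewrite ?addr_ge0// lerD2r ler_wpM2l.
Qed.

(** The radius t.2 is returned with the net because its formula changes at [g0]; in both cases
    sigma(t.2) <= v. *)
Lemma covering_net v : 0 < v -> exists t : seq (R * R) * R,
  [/\ (size t.1)%:R <= covering_bound v,
      forall z, z \in t.1 -> (`[a, b] `*` `[c, d]) z,
      forall p, (`[a, b] `*` `[c, d]) p ->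
        exists2 z, z \in t.1 & Num.max `|p.1 - z.1| `|p.2 - z.2| <= t.2,
      0 < t.2 /\ K / Z (1 / t.2 + u0) <= v &
      v < g0 -> t.2 = 1 / q v].
Proof.
move=> v0; rewrite /covering_bound; case: ifPn => [vg|]; last first.
  (* In the maximum norm every point of the rectangle is within [vk] of the corner (a, c). *)
  rewrite -leNgt => gv; exists ([:: (a, c)], vk); split => //=.
  - by move=> z; rewrite inE => /eqP ->; split; rewrite /= in_itv/= lexx.
  - move=> [x y] [/=]; rewrite !in_itv/= => /andP[ax xb] /andP[cy yd].
    exists (a, c); rewrite ?mem_head//= ge_max !ger0_norm ?subr_ge0//.
    by rewrite /vk !le_max !lerD2r xb yd orbT.
have q0 := q_gt0 v0 vg; have h0 : 0 < 1 / q v by rewrite divr_gt0.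
have [s [s1 s2 s3]] := rectangle_net le_ab le_cd h0.
exists (s, 1 / q v); split => //=.
  rewrite (le_trans s1)// (_ : (b - a) / (2 * (1 / q v)) = (b - a) / 2 * q v).
    by rewrite (_ : (d - c) / (2 * (1 / q v)) = (d - c) / 2 * q v)//; field;
      rewrite gt_eqF.
  by field; rewrite gt_eqF.
split => //; rewrite !div1r invrK; have [_ ->] := inv_radiusP v0 vg.
by rewrite invf_div mulrC divfK// gt_eqF.
Qed.

Lemma sigma_invE Cy Cz v : K = 2 * Cy * Cz -> 0 < v -> v < g0 ->
  sigma_inv Cy Cz Z u0 vk v = 1 / q v.
Proof.
move=> KE v0 vg; have [kq Zq] := inv_radiusP v0 vg; have q0 := q_gt0 v0 vg.
have vE : v = sigma Cy Cz Z u0 (1 / q v).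
  by rewrite /sigma -KE !div1r invrK Zq invf_div mulrC divfK// gt_eqF.
rewrite {1}vE /sigma_inv inv_onK//.
  move=> x y /=; rewrite !in_itv/= => /andP[x0 _] /andP[y0 _] xy.
  rewrite /sigma -KE ltr_pM2l// ltf_pV2 ?posrE ?Zh_gt0//.
  apply: (admissible_incr Z_adm); first by rewrite addr_ge0// divr_ge0// ltW.
  by rewrite ltrD2r ltr_pM2l// ltf_pV2.
by rewrite /= in_itv/= divr_gt0//= ltr_pdivrMr// mulrC -ltr_pdivrMr.
Qed.

End Covering.

(** * Averages of [r] over covering numbers against the entropy integral *)

Section EntropyIntegral.
Context {R : realType}.
Variables (phi Z r : R -> R) (u0 a b c d Cy Cz : R).
Hypotheses (Z_adm : admissible phi Z u0) (le_ab : a <= b) (le_cd : c <= d).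
Hypotheses (Cy_gt0 : 0 < Cy) (Cz_gt0 : 0 < Cz).
Hypothesis r_ge0 : forall x, 1 <= x -> 0 <= r x.
Hypothesis r_incr : {in `[1, +oo[ &, {homo r : x x' / x < x'}}.

Let vk := Num.max (b - a) (d - c).
Hypothesis vk_gt0 : 0 < vk.

Let K := 2 * Cz * Cy.
Let g0 := gamma0 Cy Cz Z u0 vk.

Let KE : K = 2 * Cy * Cz. Proof. by rewrite /K mulrAC. Qed.
Let K_gt0 : 0 < K. Proof. by rewrite !mulr_gt0. Qed.
Let g0E : g0 = K / Z (1 / vk + u0). Proof. by rewrite KE. Qed.

Let N := covering_bound Z u0 a b c d K.

Let r_le x y : 1 <= x -> x <= y -> r x <= r y.
Proof.
move=> x1; rewrite le_eqVlt => /predU1P[->//|xy].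
by apply/ltW/r_incr => //; rewrite in_itv/= andbT// (le_trans x1)// ltW.
Qed.

Hypothesis entropy_fin : forall e, 0 < e -> e <= g0 ->
  (entropy_integral Cy Cz Z u0 a b c d r e < +oo)%E.

Lemma entropy_lower_sum th T n : 0 < th -> th < 1 -> 0 < T ->
  (g0 < T -> r 1 = 0) ->
  geo_mean th n (fun k => r (N (th ^+ k * T))) + th ^+ n * r 1 <=
    I_hat Cy Cz Z u0 a b c d r (Num.min T g0) / T.
Proof.
move=> th0 th1 T0 gT; have g00 : 0 < g0 by rewrite g0E;
  exact: covering_scale_gt0 Z_adm K_gt0 vk_gt0.
set del := Num.min T g0.
have del0 : 0 < del by rewrite lt_min T0.
have delg : del <= g0 by rewrite ge_min lexx orbT.
have N1 v : 0 < v -> 1 <= N v.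
  by move=> v0; apply: (covering_bound_ge1 K Z_adm).
have FN v : 0 < v -> v < g0 -> N v =
   ((b - a) / 2 * (inv_on `[0, +oo[ Z (2 * Cz * Cy / v) - u0) + 1) *
   ((d - c) / 2 * (inv_on `[0, +oo[ Z (2 * Cz * Cy / v) - u0) + 1).
  by move=> v0 vg; rewrite /N /covering_bound -/vk -g0E vg.
have G_ni s t : 0 < s -> s <= t -> r (N t) <= r (N s).
  move=> s0 st; apply: r_le; first by apply: N1; exact: lt_le_trans st.
  exact: (covering_bound_ni Z_adm le_ab le_cd K_gt0 vk_gt0).
have Gr1 s : 0 < s -> r 1 <= r (N s) by move=> s0; exact/r_le/N1.
have r10 : 0 <= r 1 by exact: r_ge0.
have mG (T' : R) : measurable_fun `]0, T'[ (fun s => (r (N s))%:E).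
  apply/measurable_EFinP; apply: nonincreasing_in_measurable.
    exact: interval_is_interval.
  by move=> s t /=; rewrite !in_itv/= => /andP[s0 _] _; exact: G_ni.
have G0 s : 0 < s -> (0 <= (r (N s))%:E)%E by move=> s0; rewrite lee_fin r_ge0// N1.
pose I := (\int[lebesgue_measure]_(s in `]0%R, del[) (r (N s))%:E)%E.
have I_entropy : I = entropy_integral Cy Cz Z u0 a b c d r del.
  rewrite /I /entropy_integral; apply: eq_integral => v.
  rewrite inE/= in_itv/= => /andP[v0 /lt_le_trans/(_ delg) vg].
  rewrite (sigma_invE Z_adm K_gt0 vk_gt0 KE v0); last by rewrite -g0E.
  rewrite FN// /inv_radius -/K; set q := _ - u0.
  have q0 : q != 0.
    by rewrite gt_eqF//; have [] := inv_radiusP (K := K) Z_adm vk_gt0 v0;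
      rewrite -?g0E// => /(lt_trans _) + _; apply; rewrite divr_gt0.
  by congr ((r ((_ + 1) * (_ + 1)))%:E); field.
have I_hatE : I_hat Cy Cz Z u0 a b c d r del = fine I.
  rewrite /I_hat; congr fine; apply: eq_integral => v.
  by rewrite inE/= in_itv/= => /andP[v0 /lt_le_trans/(_ delg) vg]; rewrite FN.
(* [I_hat] is a [fine], which would turn an infinite integral into 0; the entropy hypothesis at
   [del] <= g0 excludes this. *)
have I_fin : I = (fine I)%:E.
  rewrite fineK// ge0_fin_numE ?I_entropy ?entropy_fin// -I_entropy.
  by apply: integral_ge0 => v /=; rewrite in_itv/= => /andP[v0 _]; exact: G0.
(* Beyond [g0] the integrand is the constant r 1, which vanishes whenever T exceeds [g0]. *)
have IT : (\int[lebesgue_measure]_(s in `]0%R, T[) (r (N s))%:E)%E = I.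
  have [Tg|gT0] := leP T g0; first by rewrite /I /del min_l.
  have r1 := gT gT0; have delE : del = g0 by rewrite /del min_r// ltW.
  have TE : `]0, T[%classic = `]0, g0[%classic `|` `[g0, T[%classic.
    by rewrite -itv_bndbnd_setU// bnd_simp ltW.
  rewrite TE ge0_integral_setU//=; last 3 first.
  - by rewrite -TE; exact: mG.
  - by move=> s [|]/=; rewrite in_itv/= => /andP[s0 _]; apply: G0 => //;
    exact: lt_le_trans s0.
  - apply/disj_setPS => s [/=]; rewrite !in_itv/= => /andP[_ s1] /andP[s2 _].
    by have := lt_le_trans s1 s2; rewrite ltxx.
  rewrite [X in (_ + X)%E]integral0_eq ?adde0 /I ?delE//.
  move=> s /=; rewrite in_itv/= => /andP[gs _].
  by rewrite /N /covering_bound -/vk -g0E ltNge gs/= r1.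
rewrite I_hatE ler_pdivlMr// -lee_fin -I_fin -IT.
exact: geo_lower_sum.
Qed.

End EntropyIntegral.

(** * Exponential moments of the field and of its increments *)

Section Field.
Context {R : realType}.

Lemma continuous_symbol N (ak : nat -> R) : continuous (symbol N ak).
Proof.
move=> l; apply: cvg_big => [|k _]; first exact: add_continuous.
by apply: cvgMl; apply: cvgMr; exact: exprn_continuous.
Qed.

Lemma continuous_kernelI (kappa : R -> R) N ak t x :
  kappa = cos \/ kappa = sin -> continuous (kernelI kappa N ak t x).
Proof.
move=> kcs l; rewrite /kernelI.
apply: (@continuous_cvg _ _ _ _ _ (fun l : R => l * x + t * symbol N ak l) kappa).
  by case: kcs => ->; [exact: continuous_cos|exact: continuous_sin].
apply: cvgD; first exact: mulrr_continuous.
by apply: cvgMr; exact: continuous_symbol.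
Qed.

Lemma kernelI_le1 (kappa : R -> R) N ak t x l :
  kappa = cos \/ kappa = sin -> `|kernelI kappa N ak t x l| <= 1.
Proof.
by case=> ->; rewrite /kernelI ler_norml ?cos_geN1 ?cos_le1 ?sin_geN1 ?sin_le1.
Qed.

Lemma measurable_weight phi N ak (Z : R -> R) u0 : admissible phi Z u0 ->
  measurable_fun setT (weight N ak Z u0).
Proof.
move=> Z_adm; have u0_ge0 := admissible_u0 Z_adm.
(* Z is controlled on [0, +oo[ only; this version is monotone on the whole line, hence measurable,
   and agrees with Z at the arguments in [weight]. *)
pose Zm x := Z (Num.max x 0).
have mZ : measurable_fun setT Zm.
  apply: nondecreasing_measurable => // x y xy; apply: (admissible_le Z_adm).
    by rewrite le_max lexx orbT.
  by rewrite ge_max !le_max xy lexx orbT.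
have ZE (f : R -> R) l : Z (`|f l| / 2 + u0) = Zm (`|f l| / 2 + u0).
  by rewrite /Zm max_l// addr_ge0// divr_ge0.
rewrite (_ : weight N ak Z u0 = (fun l => Zm (`|l| / 2 + u0) + Zm (`|symbol N
  ak l| / 2 + u0))); last first.
  by apply/funext => l; rewrite /weight (ZE id) (ZE (symbol N ak)).
have mc (f : R -> R) : continuous f ->
  measurable_fun setT (fun l => Zm (`|f l| / 2 + u0)).
  move=> cf; apply: measurableT_comp => //; apply: continuous_measurable_fun => l.
  apply: cvgD; last exact: cvg_cst.
  apply: cvgMl; apply: continuous_comp; [exact: cf|exact: norm_continuous].
apply: measurable_funD; first by apply: (mc id) => l; exact: cvg_id.
by apply: mc; exact: continuous_symbol.
Qed.

Lemma weight_ge0 phi N ak (Z : R -> R) u0 l : admissible phi Z u0 ->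
  0 <= weight N ak Z u0 l.
Proof.
move=> Z_adm; have u0_ge0 := admissible_u0 Z_adm.
by rewrite addr_ge0// (admissible_ge0 Z_adm)// addr_ge0// divr_ge0.
Qed.

Context {d : measure_display} {Omega : measurableType d}.
Variable P : probability Omega R.
Variables (phi : R -> R) (N : nat) (ak : nat -> R) (kappa : R -> R).
Hypotheses (phiN : Orlicz_Nfunction phi) (kappa_cs : kappa = cos \/ kappa = sin).
Variables (y : R -> {RV P >-> R}) (Cy : R).
Hypothesis y_strict : strictly_sub_gaussian_process phi y Cy.
Variables (nu : {charge set @planeR R -> \bar R}) (Pos Neg : set (@planeR R)).
Variable nuPN : hahn_decomposition nu Pos Neg.
Hypothesis y_nu : LS_bimeasure (covariance_fun y) nu.

(** A crude bound from |I| <= 1 and the finite total mass of the variation. It makes [eps0] finite,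
    and forces eps0 = 0 when Cy <= 0. *)
Lemma kernel_integral_mgf_le t x (X : {RV P >-> R}) :
  is_ms_integral (kernelI kappa N ak t x) y X ->
  mgf_le P phi X (Num.max Cy 0 * Num.sqrt (fine (charge_variation nuPN setT))).
Proof.
move=> /ms_integral_RS_approx X_int.
set M := fine _.
have M0 : 0 <= M by rewrite fine_ge0.
apply: (RS_approx_mgf_le (nuPN := nuPN) phiN y_strict y_nu X_int) => //.
- exact: continuous_kernelI.
rewrite sqr_sqrtr//.
have cnk : continuous (fun z => `|kernelI kappa N ak t x z|).
  by move=> z; apply: continuous_comp;
    [exact: continuous_kernelI|exact: norm_continuous].
apply: (@le_trans _ _ (\int[charge_variation nuPN]_p (cst 1%E p))%E).
  apply: ge0_le_integral => //.
  - exact: (measurable_mul_plane cnk).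
  - by move=> p _; rewrite lee_fin -[1]mulr1 ler_pM// kernelI_le1.
by rewrite integral_cst// mul1e /M fineK// fin_num_measure.
Qed.

Lemma kernel_increment_mgf_le Z u0 t x t' x' h (X X' : {RV P >-> R}) :
  admissible phi Z u0 -> (CZ2 nuPN N ak Z u0 < +oo)%E ->
  is_ms_integral (kernelI kappa N ak t x) y X ->
  is_ms_integral (kernelI kappa N ak t' x') y X' ->
  0 < h -> `|t - t'| <= h -> `|x - x'| <= h ->
  mgf_le P phi (X - X' : {mfun _ >-> _})
    (Num.max Cy 0 * (2 / Z (1 / h + u0) * CZ nuPN N ak Z u0)).
Proof.
move=> Z_adm CZ_fin /ms_integral_RS_approx X_int /ms_integral_RS_approx X'_int
  h0 th xh.
have Z0 : 0 < Z (1 / h + u0).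
  by apply: (admissible_gt0 Z_adm);
    rewrite ltr_wpDr ?(admissible_u0 Z_adm)// divr_gt0.
set s := 2 / Z (1 / h + u0).
have s0 : 0 <= s by rewrite divr_ge0// ltW.
have w0 l : 0 <= weight N ak Z u0 l by exact: (weight_ge0 _ _ _ Z_adm).
have CZ2_ge0 : (0 <= CZ2 nuPN N ak Z u0)%E.
  by apply: integral_ge0 => p _; rewrite lee_fin mulr_ge0.
pose f l := kernelI kappa N ak t x l - kernelI kappa N ak t' x' l.
have XX' : RS_approx f y (X - X' : {mfun _ >-> _}) := RS_approxB X_int X'_int.
have cf : continuous f.
  by move=> l; apply: cvgB; exact: continuous_kernelI.
apply: (RS_approx_mgf_le (nuPN := nuPN) phiN y_strict y_nu XX') => //.
  by rewrite mulr_ge0// sqrtr_ge0.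
rewrite exprMn /CZ sqr_sqrtr ?fine_ge0// EFinM fineK ?ge0_fin_numE//.
have cnf : continuous (fun z => `|f z|).
  by move=> z; apply: continuous_comp; [exact: cf|exact: norm_continuous].
have mw := measurable_weight N ak Z_adm.
have mww : measurable_fun setT (fun p : @planeR R => (weight N ak Z u0 p.1 *
  weight N ak Z u0 p.2)%:E).
  apply/measurable_EFinP.
  have mw' : measurable_fun (setT : set (measurableTypeR R)) (weight N ak Z u0)
    by [].
  by apply: measurable_funM; apply: measurableT_comp.
rewrite /CZ2 -ge0_integralZl//; last 2 first.
- by move=> p _; rewrite lee_fin mulr_ge0.
- by rewrite lee_fin sqr_ge0.
apply: ge0_le_integral => //.
- exact: (measurable_mul_plane cnf).
- exact: emeasurable_funM.
move=> p _; rewrite -EFinM lee_fin.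
rewrite (_ : s ^+ 2 * _ = (s * weight N ak Z u0 p.1) * (s * weight N ak Z u0
  p.2)); last by ring.
by apply: ler_pM => //; exact: (dist_kernelI _ _ _ kappa_cs Z_adm).
Qed.

End Field.

(** * Null events over finite nets, for the degenerate cases *)

Section NullEvents.
Context {d : measure_display} {Omega : measurableType d} {R : realType}.
Variable P : probability Omega R.

Lemma null_has_gt (T : choiceType) (X : T -> {RV P >-> R}) (s : seq T) (u : R) :
  (forall t, t \in s -> P [set w | u < `|X t w|] = 0%E) ->
  P [set w | has (fun t => u < `|X t w|) s] = 0%E.
Proof.
elim: s => [|t s IH] H; first by rewrite (_ : [set _ | _] = set0) ?measure0//;
  apply/seteqP; split.
apply/eqP; rewrite eq_le measure_ge0 andbT.
rewrite (_ : [set _ | _] = [set w | u < `|X t w|] `|` [set w | has (fun t => u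
  < `|X t w|) s]); last first.
  by apply/seteqP; split => w /= /orP.
apply: (@le_trans _ _ (P [set w | (u < `|X t w|)%R] +
  P [set w | has (fun t => (u < `|X t w|)%R) s])%E).
  by apply: measureU2; [exact: measurable_norm_gt|exact: measurable_has_gt].
rewrite H ?mem_head// IH ?adde0// => z zs.
by apply: H; rewrite inE zs orbT.
Qed.

Lemma has_gt_const (T : choiceType) (X : T -> {RV P >-> R}) (s : seq T) t0 (u : R) :
  (forall t, t \in s -> P [set w | 0 < `|X t w - X t0 w|] = 0%E) ->
  (P [set w | has (fun t => (u < `|X t w|)%R) s] <= P [set w | (u < `|X t0
    w|)%R])%E.
Proof.
move=> H; pose Y t : {RV P >-> R} := (X t - X t0 : {mfun _ >-> _}).
have Y0 : P [set w | has (fun t => 0 < `|Y t w|) s] = 0%E by exact: null_has_gt.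
rewrite -[leRHS]adde0 -Y0.
apply: (@le_trans _ _ (P ([set w | u < `|X t0 w|] `|` [set w | has (fun t => 0
  < `|Y t w|) s]))); last first.
  by apply: measureU2; [exact: measurable_norm_gt|exact: measurable_has_gt].
apply: le_measure; rewrite ?inE; [exact: measurable_has_gt|apply: measurableU;
  [exact: measurable_norm_gt|exact: measurable_has_gt]|].
move=> w /= /hasP[t ts ut]; have [Y_gt0|] := ltP 0 `|Y t w|.
  by right; apply/hasP; exists t.
rewrite normr_le0 subr_eq0 => /eqP XX; left; by rewrite -XX.
Qed.

End NullEvents.

Theorem theorem3p3 (R : realType) (disp : measure_display)
  (Omega : measurableType disp) (P : probability Omega R)
  (phi : R -> R)
  (phiN : Orlicz_Nfunction phi) (phiQ : condition_Q phi)
  (N : nat) (N_ge1 : (1 <= N)%N) (ak : nat -> R)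
  (kappa : R -> R) (kappa_cs : kappa = cos \/ kappa = sin)
  (y : R -> {RV P >-> R}) (Cy : R)
  (y_strict : strictly_sub_gaussian_process phi y Cy)
  (y_fv : finite_variation (covariance_fun y))
  (* [nu] is the bimeasure generated by the covariance function of [y], and
     [charge_variation nuPN] is its total variation *)
  (nu : {charge set @planeR R -> \bar R})
  (y_nu : LS_bimeasure (covariance_fun y) nu)
  (Pos Neg : set (@planeR R)) (nuPN : hahn_decomposition nu Pos Neg)
  (a b c d : R) (le_ab : a <= b) (le_cd : c <= d)
  (U : R -> R -> {RV P >-> R})
  (U_int : forall t x, t \in `[a, b] -> x \in `[c, d] ->
     is_ms_integral (kernelI kappa N ak t x) y (U t x))
  (U_cont : {ae P, forall w,
     {within `[a, b] `*` `[c, d], continuous (fun p : R * R => U p.1 p.2 w)}})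
  (Z : R -> R) (u0 : R) (Z_adm : admissible phi Z u0)
  (CZ_fin : (CZ2 nuPN N ak Z u0 < +oo)%E)
  (r : R -> R)
  (r_ge0 : forall x, 1 <= x -> 0 <= r x)
  (r_incr : {in `[1, +oo[ &, {homo r : x x' / x < x'}})
  (r_exp_convex :
     convex_function (E := R^o) `[0, +oo[ (fun x => r (expR x))) :
  let Cz := CZ nuPN N ak Z u0 in
  let vk := Num.max (b - a) (d - c) in
  let g0 := gamma0 Cy Cz Z u0 vk in
  let eps0 := fine (ereal_sup
    [set tau phi (U p.1 p.2) | p in `[a, b] `*` `[c, d]]) in
  0 < vk ->
  (forall e, 0 < e -> e <= g0 ->
     (entropy_integral Cy Cz Z u0 a b c d r e < +oo)%E) ->
  forall theta u : R, 0 < theta -> theta < 1 -> 0 < u ->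
  (* On ]g0, theta * eps0[ the covering number is 1 and contributes r 1 to the
     entropy average, a term that I_hat (min (theta * eps0) g0) omits; if it
     does not vanish the bound is false, since it can then be decreased
     arbitrarily by adding a constant to r. *)
  (g0 < theta * eps0 -> r 1 = 0) ->
  (mu_ext P [set w | (u%:E <
       ereal_sup [set `|U p.1 p.2 w|%:E | p in `[a, b] `*` `[c, d]])%E]
   <= (2 * A_hat phi Cy Cz Z u0 a b c d r eps0 theta u)%:E)%E.
Proof.
move=> Cz vk g0 eps0 vk0 ent th u th0 th1 u0_gt0 g0th.
pose rect : set (R * R) := `[a, b] `*` `[c, d].
pose X (p : R * R) : {RV P >-> R} := U p.1 p.2.
have X_int p : rect p -> is_ms_integral (kernelI kappa N ak p.1 p.2) y (X p).
  by move=> [p1 p2]; exact: U_int.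
have Cy0 : 0 <= Num.max Cy 0 by rewrite le_max lexx orbT.
have Cz0 : 0 <= Cz by exact: sqrtr_ge0.
pose M := Num.max Cy 0 * Num.sqrt (fine (charge_variation nuPN setT)).
have M0 : 0 <= M by rewrite mulr_ge0// sqrtr_ge0.
have tauM p : rect p -> (tau phi (X p) <= M%:E)%E.
  move=> /X_int Xp; apply: mgf_le_tau_le => //.
  exact: (kernel_integral_mgf_le phiN kappa_cs y_strict nuPN y_nu Xp).
have p0r : rect (a, c) by split; rewrite /= in_itv/= lexx.
pose S := ereal_sup [set tau phi (U p.1 p.2) | p in rect].
have S_ge p : rect p -> (tau phi (X p) <= S)%E.
  by move=> pr; apply: ereal_sup_ubound; exists p.
have S0 : (0 <= S)%E := le_trans (tau_ge0 _ _) (S_ge _ p0r).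
have SM : (S <= M%:E)%E by apply: ge_ereal_sup => _ [p pr <-]; exact: tauM.
have Sfin : S = eps0%:E.
  by rewrite fineK// ge0_fin_numE// (le_lt_trans SM)// ltry.
have eps_ge0 : 0 <= eps0 by rewrite -lee_fin -Sfin.
have Xeps p : rect p -> mgf_le P phi (X p) eps0.
  by move=> /S_ge; rewrite Sfin; exact: tau_le_mgf_le.
have incr p q h : rect p -> rect q -> 0 < h ->
  Num.max `|p.1 - q.1| `|p.2 - q.2| <= h ->
    mgf_le P phi (X p - X q : {mfun _ >->
      _}) (Num.max Cy 0 * (2 / Z (1 / h + u0) * Cz)).
  move=> /X_int Xp /X_int Xq h0; rewrite ge_max => /andP[h1 h2].
  exact: (kernel_increment_mgf_le phiN kappa_cs y_strict y_nu Z_adm CZ_fin Xp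
    Xq h0 h1 h2).
(* Nets of mesh 1 / (n + 1) for the degenerate cases, where sigma^(-1) provides no radii. *)
have /choice[W WP] n : exists s : seq (R * R), (forall z, z \in s -> rect z) /\
    forall p, rect p -> exists2 z, z \in s & Num.max `|p.1 - z.1| `|p.2 - z.2|
      <= n.+1%:R^-1.
  have h0 : 0 < n.+1%:R^-1 :> R by rewrite invr_gt0.
  by have [s [_ s2 s3]] := rectangle_net le_ab le_cd h0; exists s.
have Wrect n z : z \in W n -> rect z by have [+ _] := WP n; apply.
have Wmesh delta : 0 < delta -> exists n0, forall n, (n0 <= n)%N ->
  forall p, rect p ->
    exists2 z, z \in W n & Num.max `|p.1 - z.1| `|p.2 - z.2| <= delta.
  move=> /ltr_add_invr[n0]; rewrite add0r => n0d; exists n0 => n n0n p pr.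
  have [_ /(_ p pr)[z zW pz]] := WP n; exists z => //.
  rewrite (le_trans pz)// (le_trans _ (ltW n0d))// lef_pV2 ?posrE// ler_nat ltnS//.
have [eps00|eps_neq0] := eqVneq eps0 0.
  have null p : rect p -> P [set w | 0 < `|X p w|] = 0%E.
    by move=> pr; apply: (mgf_le0_null phiN) => //; rewrite -eps00; exact: Xeps.
  apply: (sup_tail U_cont Wrect Wmesh) => n.
  rewrite (@le_trans _ _ 0%E)//; last first.
    by rewrite lee_fin mulr_ge0// mulr_ge0 ?expR_ge0// inv_on_ge0.
  rewrite (_ : P _ = 0%E)//; apply: (null_has_gt (X := X)) => t tW.
  apply/eqP; rewrite eq_le measure_ge0 andbT -(null t (Wrect _ _ tW)).
  apply: le_measure; rewrite ?inE; [exact: measurable_norm_gt..|].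
  by move=> w /=; exact: lt_trans.
have eps_gt0 : 0 < eps0 by rewrite lt_neqAle eq_sym eps_neq0.
have Cy_gt0 : 0 < Cy.
  rewrite ltNge; apply/negP => Cyle.
  have MM : M = 0 by rewrite /M max_r// mul0r.
  by move: SM; rewrite Sfin MM lee_fin leNgt eps_gt0.
have maxCy : Num.max Cy 0 = Cy by rewrite max_l// ltW.
pose T := th * eps0.
have T0 : 0 < T by rewrite mulr_gt0.
pose x := u * (1 - th) / eps0.
have x0 : 0 <= x by rewrite divr_ge0 ?mulr_ge0// ?subr_ge0 ltW.
(* If Cz = 0 then g0 = 0 < theta eps0, which forces r 1 = 0; [I_hat] is an integral over the empty
   set, and the inverse of [r] at 0 is 1. *)
have [Cz00|Cz_neq0] := eqVneq Cz 0.
  have g00 : g0 = 0 by rewrite /g0 /gamma0 Cz00 mulr0 mul0r.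
  have r10 : r 1 = 0 by apply: g0th; rewrite g00.
  have A1 : inv_on `[1, +oo[ r (I_hat Cy Cz Z u0 a b c d r (Num.min (th * eps0)
    g0) / (th * eps0)) = 1.
    rewrite g00 min_r ?(ltW T0)// (_ : I_hat _ _ _ _ _ _ _ _ _ _ = 0); last first.
      by rewrite /I_hat set_itvoo0 integral_set0.
    rewrite mul0r -r10.
    by rewrite inv_onK//= ?in_itv/= ?lexx// => v w v1 w1; apply: r_incr.
  rewrite /A_hat -/g0 A1; apply: (sup_tail U_cont Wrect Wmesh) => n.
  have const t : t \in W n -> P [set w | 0 < `|X t w - X (a, c) w|] = 0%E.
    move=> /Wrect tr; pose h := Num.max 1 (Num.max `|t.1 - a| `|t.2 - c|).
    have h0 : 0 < h by rewrite lt_max ltr01.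
    have := incr t (a, c) h tr p0r h0;
      rewrite Cz00 !mulr0 => /(_ ltac:(by rewrite le_max lexx orbT)).
    by move=> /(mgf_le0_null phiN); apply.
  apply: le_trans (has_gt_const u const) _.
  apply: (Young_Fenchel_tail phiN (measurable_norm_gt _ _)) => // l l0.
  have -> : [set w | u < `|X (a, c) w|] = [set w | has (fun t => u < `|X t w|)
    [:: (a, c)]].
    by apply/seteqP; split => w /=; rewrite orbF.
  (* Chaining over the single point (a, c), stopped at level 0, is the exponential bound for one
     variable with u (1 - th) in place of u. *)
  have := @chaining_tail _ _ _ P _ X phi phiN (fun=> [:: (a,
    c)]) (fun _ t => t) (fun=> 1) eps0 th
     eps_gt0 th0 th1 (fun _ => lexx _) (fun _ => lexx _) (fun _ _ tV => tV) _
       0%N u l l0.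
  rewrite /geo_mean big_ord1 ln1 mulr0 expR0; apply.
  move=> k t; rewrite inE => /eqP ->; case: k => [|k];
    first by rewrite expr0 mul1r; exact: Xeps.
  have e0 : 0 <= th ^+ k.+1 * eps0 by rewrite mulr_ge0// exprn_ge0// ltW.
  apply: (mgf_leW phiN (lexx 0) e0).
  have := incr (a, c) (a, c) 1 p0r p0r ltr01; rewrite Cz00 !mulr0; apply.
  by rewrite !subrr normr0 maxxx.
have Cz_gt0 : 0 < Cz by rewrite lt_neqAle eq_sym Cz_neq0.
pose K := 2 * Cz * Cy; have K0 : 0 < K by rewrite !mulr_gt0.
have KE : K = 2 * Cy * Cz by rewrite /K mulrAC.
(* Since T = th eps0, the net V k has scale th^(k+1) eps0, as required for the link from level k + 1
   down to level k. *)
pose v k := th ^+ k * T.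
have v0 k : 0 < v k by rewrite mulr_gt0// exprn_gt0.
pose Nb k := covering_bound Z u0 a b c d K (v k).
have Nb1 k : 1 <= Nb k by apply: (covering_bound_ge1 K Z_adm).
have /choice[V VP] k := covering_net Z_adm le_ab le_cd K0 vk0 (v0 k).
have /choice[pr0 pr0P] (kt : nat * (R * R)) : exists z, rect kt.2 ->
    z \in (V kt.1).1 /\ Num.max `|kt.2.1 - z.1| `|kt.2.2 - z.2| <= (V kt.1).2.
  have [kr|] := pselect (rect kt.2); last by exists (a, c).
  by have [_ _ /(_ _ kr)[z zV kz] _ _] := VP kt.1; exists z.
pose pr k t := pr0 (k, t).
have V_rect k z : z \in (V k).1 -> rect z by have [_ + _ _ _] := VP k; apply.
have tail n l : 0 <= l ->
  (P [set w | has (fun t => (u < `|X t w|)%R) (V n).1] <=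
   (2 * expR (phi l - l * x) * expR (geo_mean th n.+1 (fun k => ln (Nb k))))%:E)%E.
  move=> l0; apply: (@chaining_tail _ _ _ P _ X phi phiN (fun k => (V k).1) pr
    Nb eps0 th
    eps_gt0 th0 th1 Nb1) => //.
  - by move=> k; have [] := VP k.
  - by move=> k t /V_rect tr; have [] := pr0P (k, t) tr.
  - move=> [|k] t tV; first by rewrite expr0 mul1r; exact/Xeps/(V_rect _ _ tV).
    have tr := V_rect _ _ tV; have [zV tz] := pr0P (k, t) tr.
    have [_ _ _ [h0 hv] _] := VP k.
    have := incr _ _ _ tr (V_rect _ _ zV) h0 tz.
    apply: mgf_leW => //.
      by rewrite mulr_ge0// mulr_ge0// divr_ge0// (admissible_ge0 Z_adm)//
        addr_ge0 ?(admissible_u0 Z_adm)// divr_ge0// ltW.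
    rewrite (_ : th ^+ k.+1 * eps0 = v k); last by rewrite /v /T exprSr mulrA.
    apply: le_trans hv; rewrite maxCy KE.
    by rewrite (_ : Cy * _ = 2 * Cy * Cz / Z (1 / (V k).2 + u0))//; ring.
set A := A_hat _ _ _ _ _ _ _ _ _ _ _ _ _.
have r_lower n : geo_mean th n (fun k => r (Nb k)) + th ^+ n * r 1 <=
    I_hat Cy Cz Z u0 a b c d r (Num.min T g0) / T.
  exact: (entropy_lower_sum Z_adm le_ab le_cd Cy_gt0 Cz_gt0 r_ge0 r_incr vk0
    ent n th0 th1 T0 g0th).
set I := I_hat _ _ _ _ _ _ _ _ _ _ / T in r_lower.
(* The case n = 0 of the lower sum; it places I in the range of [r], so that the inverse is
   genuine. *)
have r1I : r 1 <= I by have := r_lower 0%N; rewrite geo_mean0 add0r expr0 mul1r.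
have [z1 rz] := inv_on_exp_convex r_incr r_exp_convex r1I.
set z := inv_on _ _ _ in z1 rz.
have z0 : 0 < z by rewrite (lt_le_trans _ z1).
(* The comparison is made after applying the strictly increasing [r]: Jensen's inequality for r(e^x)
   and the lower sum give a value at most I = r z. *)
have Nz n : expR (geo_mean th n (fun k => ln (Nb k))) <= z.
  rewrite leNgt; apply/negP => zN.
  have zN1 : 1 <= expR (geo_mean th n (fun k => ln (Nb k))) := le_trans z1 (ltW zN).
  have := r_incr _ _ _ _ zN; rewrite !in_itv/= !andbT => /(_ z1 zN1).
  rewrite rz ltNge => /negP; apply; apply: le_trans (r_lower n).
  have lnN k : 0 <= ln (Nb k) by rewrite ln_ge0.
  have := geo_mean_convex n r_exp_convex lnN (ltW th0) (ltW th1).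
  rewrite expR0 (_ : (fun x => r (expR x)) \o (fun k => ln (Nb k)) = (fun k =>
    r (Nb k)))//.
  by apply/funext => k /=; rewrite lnK// posrE (lt_le_trans _ (Nb1 k)).
have Vmesh delta : 0 < delta -> exists n0, forall n, (n0 <= n)%N ->
  forall p, rect p ->
    exists2 q, q \in (V n).1 & Num.max `|p.1 - q.1| `|p.2 - q.2| <= delta.
  move=> delta0; have [w w0 wP] := inv_radius_small Z_adm K0 vk0 delta0.
  have : v n @[n --> \oo] --> 0.
    rewrite -(mul0r T); apply: cvgMl; apply: cvg_expr; rewrite ger0_norm// ltW//.
  move=> /cvgr_le /(_ w w0)[n0 _ n0P]; exists n0 => n n0n p pr'.
  have [vg qd] := wP _ (v0 n) (n0P n n0n).
  have [_ _ /(_ p pr')[q qV pq] _ radE] := VP n; exists q => //.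
  by rewrite (le_trans pq)// radE.
apply: (sup_tail U_cont (W := fun n => (V n).1) V_rect Vmesh) => n.
apply: (Young_Fenchel_tail phiN (measurable_has_gt X _ _)) => // l l0.
apply: (le_trans (tail n l l0)); rewrite lee_fin ler_wpM2l// mulr_ge0// expR_ge0.
Qed.
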